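(* Let $\mathcal N=\mathbb R^2\setminus\{0\}$ with coordinates $(u,v)$ and the Lorentz metric $\dfrac{du\odot dv}{u^2+v^2}$. Then all null geodesics of $\mathcal N$ are complete.
   Context: A geodesic is null if its velocity $(\dot u,\dot v)$ satisfies $\dot u\dot v\equiv 0$. **Complexification.** $\mathcal N$ is complexified by the inclusion $d:\mathcal N\to M=\mathbb C^2\setminus\big((1,i)\mathbb C\cup(1,-i)\mathbb C\big)$, $M$ having the holomorphic metric $\frac{du\odot dv}{u^2+v^2}$. **Riemann surface of a germ.** An analytical continuation of a germ of a holomorphic map $f:U\to M$ ($U\subset\mathbb C$ a region) is a quadruple $(S,\pi,j,G)$: $S$ a connected Riemann surface, $\pi:S\to\mathbb C$ nonconstant holomorphic with $U\subset\pi(S)$, $j:U\to S$ a holomorphic immersion with $\pi\circ j=\mathrm{id}_U$, $G:S\to M$ holomorphic with $G\circ j=f$. A morphism from $(T,\varrho,\ell,H)$ to $(S,\pi,j,G)$ is a holomorphic $h:T\to S$ with $h\circ\ell=j$. The Riemann surface of the germ is its maximal analytical continuation, i.e. the one (unique up to isomorphism) to which every analytical continuation admits a morphism. **Completeness.** A real-analytic curve $\gamma$ in $\mathcal N$ is *complete* if $d\circ\gamma$ can be continued analytically to all points of the real line, with at most a discrete set of exceptional values, taking values in $d(\mathcal N)$; that is, if the Riemann surface $(S,\pi,j,G)$ of $d\circ\gamma$ is such that $\mathbb R\setminus\pi(G^{-1}(d(\mathcal N)))$ is a discrete set. *)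

(* Defs.v *)
From HB Require Import structures.
From mathcomp Require Import all_boot all_order all_algebra.
From mathcomp Require Import all_classical all_reals all_analysis.
From mathcomp Require Import complex.

Set Implicit Arguments.
Unset Strict Implicit.
Unset Printing Implicit Defensive.

Import Order.TTheory GRing.Theory Num.Theory numFieldNormedType.Exports.

Local Open Scope classical_set_scope.
Local Open Scope ring_scope.
Local Open Scope complex_scope.

(* The type ascription makes [Cplx R] a normed module over itself, with the
   topology of the modulus. *)
Definition Cplx (R : realType) : numClosedFieldType := R[i].

Definition rtoc (R : realType) (x : R) : Cplx R := x%:C.

Definition vec2 (K : Type) (a b : K) : 'rV[K]_2 :=
  \row_(j < 2) (if j == 0 then a else b).

(* The scalars being [Cplx R], the increment [h] in
   [derivable f z 1], i.e. in the limit of [h^-1 *: (f (h + z) - f z)],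
   is complex: this is complex differentiability at [z]. *)
Definition holomorphic_on (R : realType) (V : normedModType (Cplx R))
    (A : set (Cplx R)) (f : Cplx R -> V) : Prop :=
  forall z, A z -> derivable f z 1.

Definition region (R : realType) (U : set (Cplx R)) : Prop :=
  [/\ U !=set0, open U & connected U].

(* Christoffel symbols of the second kind, Gamma^k_ij, of the Levi-Civita
   connection of [g]. *)
Definition christoffel (R : realType) (n : nat)
    (g : 'rV[R]_n.+1 -> 'M[R]_n.+1) (k i j : 'I_n.+1) (p : 'rV[R]_n.+1) : R :=
  2^-1 * \sum_(l < n.+1) invmx (g p) k l *
    ('D_(delta_mx 0 i) (fun q => g q j l) p
     + 'D_(delta_mx 0 j) (fun q => g q i l) p
     - 'D_(delta_mx 0 l) (fun q => g q i j) p).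

Definition geodesic (R : realType) (n : nat)
    (g : 'rV[R]_n.+1 -> 'M[R]_n.+1) (I : set R) (gamma : R -> 'rV[R]_n.+1) :
    Prop :=
  forall t, I t ->
    [/\ derivable gamma t 1,
        derivable (derive1 gamma) t 1 &
        forall k, derive1 (derive1 gamma) t 0 k
          + \sum_(i < n.+1) \sum_(j < n.+1)
              christoffel g k i j (gamma t)
              * derive1 gamma t 0 i * derive1 gamma t 0 j = 0].

Definition Nspace (R : realType) : set 'rV[R]_2 := [set p | p != 0].

(* du (.) dv / (u^2 + v^2), with du (.) dv the symmetric product
   (du (x) dv + dv (x) du) / 2; the normalization of (.) does not affect the
   geodesics. *)
Definition Nmetric (R : realType) (p : 'rV[R]_2) : 'M[R]_2 :=
  \matrix_(i < 2, j < 2)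
    (if i == j then 0 else (2 * (p 0 0 ^+ 2 + p 0 1 ^+ 2))^-1).

Definition null_curve (R : realType) (I : set R) (gamma : R -> 'rV[R]_2) :
    Prop :=
  forall t, I t -> derive1 gamma t 0 0 * derive1 gamma t 0 1 = 0.

Definition Mspace (R : realType) : set 'rV[Cplx R]_2 :=
  ~` (range (fun l : Cplx R => l *: vec2 1 'i)
      `|` range (fun l : Cplx R => l *: vec2 1 (- 'i))).

Definition complexify (R : realType) (p : 'rV[R]_2) : 'rV[Cplx R]_2 :=
  map_mx (@rtoc R) p.

Record chart (R : realType) (S : topologicalType) := Chart {
  chart_dom : set S;
  chart_map :> S -> Cplx R;
  chart_inv : Cplx R -> S
}.

Definition chart_img (R : realType) (S : topologicalType) (c : chart R S) :
    set (Cplx R) := c @` chart_dom c.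

(* [c] restricts to a homeomorphism of an open set of [S] onto an open set of
   C; the values of [chart_inv c] outside [chart_img c] are irrelevant. *)
Definition is_chart (R : realType) (S : topologicalType) (c : chart R S) :
    Prop :=
  [/\ open (chart_dom c), open (chart_img c),
      forall x, chart_dom c x -> chart_inv c (c x) = x,
      forall x, chart_dom c x -> {for x, continuous c} &
      forall z, chart_img c z -> {for z, continuous (chart_inv c)}].

(* Second countability is not required: by Rado's theorem it is automatic. *)
Record riemann_surface (R : realType) := RiemannSurface {
  rs_space :> topologicalType;
  rs_atlas : set (chart R rs_space);
  rs_nonempty : [set: rs_space] !=set0;
  rs_hausdorff : hausdorff_space rs_space;
  rs_connected : connected [set: rs_space];
  rs_charts : forall c, rs_atlas c -> is_chart c;
  rs_cover : forall x, exists2 c, rs_atlas c & chart_dom c x;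
  rs_compat : forall c c', rs_atlas c -> rs_atlas c' ->
    holomorphic_on (c @` (chart_dom c `&` chart_dom c')) (c' \o chart_inv c)
}.

Definition rs_holomorphic_fun (R : realType) (S : riemann_surface R)
    (V : normedModType (Cplx R)) (f : S -> V) : Prop :=
  forall c, rs_atlas c -> holomorphic_on (chart_img c) (f \o chart_inv c).

Definition rs_holomorphic_map (R : realType) (T S : riemann_surface R)
    (h : T -> S) : Prop :=
  continuous h /\
  forall (c : chart R T) (c' : chart R S), rs_atlas c -> rs_atlas c' ->
    holomorphic_on (c @` (chart_dom c `&` h @^-1` chart_dom c'))
                   (c' \o h \o chart_inv c).

Definition holomorphic_immersion (R : realType) (U : set (Cplx R))
    (S : riemann_surface R) (j : Cplx R -> S) : Prop :=
  forall z, U z -> {for z, continuous j} /\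
    forall c : chart R S, rs_atlas c -> chart_dom c (j z) ->
      derivable (c \o j) z 1 /\ 'D_1 (c \o j) z != 0.

(* [f] and [ac_emb] are maps on [U], represented by total functions whose
   values outside [U] are irrelevant. *)
Record continuation (R : realType) (U : set (Cplx R))
    (f : Cplx R -> 'rV[Cplx R]_2) := Continuation {
  ac_surf :> riemann_surface R;
  ac_proj : ac_surf -> Cplx R;
  ac_emb : Cplx R -> ac_surf;
  ac_map : ac_surf -> 'rV[Cplx R]_2;
  ac_proj_holo : rs_holomorphic_fun ac_proj;
  ac_proj_nonconst : exists x y, ac_proj x != ac_proj y;
  ac_proj_onto : U `<=` range ac_proj;
  ac_emb_immersion : holomorphic_immersion U ac_emb;
  ac_emb_section : forall z, U z -> ac_proj (ac_emb z) = z;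
  ac_map_holo : rs_holomorphic_fun ac_map;
  ac_map_M : forall x, @Mspace R (ac_map x);
  ac_map_ext : forall z, U z -> ac_map (ac_emb z) = f z
}.

Definition ac_morphism (R : realType) (U : set (Cplx R))
    (f : Cplx R -> 'rV[Cplx R]_2) (T S : continuation U f) (h : T -> S) :
    Prop :=
  rs_holomorphic_map h /\
  forall z, U z -> h (ac_emb T z) = ac_emb S z.

Definition is_riemann_surface_of (R : realType) (U : set (Cplx R))
    (f : Cplx R -> 'rV[Cplx R]_2) (S : continuation U f) : Prop :=
  forall T : continuation U f, exists h : T -> S, ac_morphism h.

(* [f], on the region [U] of C, is a holomorphic map to [M] extending
   [complexify \o gamma]; such an extension exists iff [gamma] is
   real-analytic on the open interval [I]. *)
Definition holomorphic_extension (R : realType) (I : set R)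
    (gamma : R -> 'rV[R]_2) (U : set (Cplx R)) (f : Cplx R -> 'rV[Cplx R]_2) :
    Prop :=
  [/\ region U, forall t, I t -> U (rtoc t),
      holomorphic_on U f, forall z, U z -> @Mspace R (f z) &
      forall t, I t -> f (rtoc t) = complexify (gamma t)].

Definition discrete_subset (T : topologicalType) (E : set T) : Prop :=
  E `<=` isolated E.

(* By the identity theorem, neither the choice of the extension [(U, f)] nor
   that of the maximal continuation [S] (unique up to isomorphism) matters. *)
Definition complete_curve (R : realType) (I : set R)
    (gamma : R -> 'rV[R]_2) : Prop :=
  exists (U : set (Cplx R)) (f : Cplx R -> 'rV[Cplx R]_2),
    holomorphic_extension I gamma U f /\
    exists2 S : continuation U f, is_riemann_surface_of S &
      discrete_subset
        [set t : R | ~ (@ac_proj _ _ _ S @`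
            (@ac_map _ _ _ S @^-1` (@complexify R @` @Nspace R))) (rtoc t)].

(* Main.v *)
Require Import Defs.
From HB Require Import structures.
From mathcomp Require Import all_boot all_order all_algebra.
From mathcomp Require Import all_classical all_reals all_analysis.
From mathcomp Require Import complex.
From mathcomp Require Import ring lra.

Set Implicit Arguments.
Unset Strict Implicit.
Unset Printing Implicit Defensive.

Import Order.TTheory GRing.Theory Num.Theory numFieldNormedType.Exports.

Local Open Scope classical_set_scope.
Local Open Scope ring_scope.

(* Along a geodesic with u'v' = 0, the quotients u'/(u^2 + v^2) and
   v'/(u^2 + v^2) are constant and one of them vanishes. Hence, up to exchanging
   the coordinates, v = c and u' = a (u^2 + c^2), so that u is constant (a = 0),
   or 1/u is affine (c = 0), or u = c tan (a c t + b). In each case u = N / D with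
   N, D entire and without common zeros, the zeros of D being real and simple.
   The Riemann surface of the germ is the plane domain {D <> 0}: on any
   continuation (T, pi, j, G), the function D(pi) G_u - N(pi) vanishes on j(U),
   hence on T, so D(pi) has no zero and pi : T -> {D <> 0} is the morphism.

   The identity theorem on T needs some function theory for functions that are
   merely complex differentiable at each point. Goursat's argument gives
   |f(z0)| <= 4 sup |f| over the boundary of a square centred at z0. Applied to
   f(z) / (z - q)^m it shows that a function vanishing near a point q vanishes on
   a disc of controlled size around q; applied to 1 / (g - w) it shows that g is
   open where g' <> 0, so that j(U) contains an open set. *)

(** * Complex moduli *)

(* The modulus as a real number: [`|z|] is an element of [Cplx R]. *)
Definition cn (R : realType) (z : Cplx R) : R := ComplexField.Normc.normc z.

Section Modulus.
Variable R : realType.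
Local Notation C := (Cplx R).
Implicit Types z w : C.

Lemma norm_cn z : `|z| = rtoc (cn z).
Proof. by []. Qed.

Lemma rtoc_le (x y : R) : (rtoc x <= rtoc y) = (x <= y).
Proof. exact: lecR. Qed.

Lemma rtoc_lt (x y : R) : (rtoc x < rtoc y) = (x < y).
Proof. exact: ltcR. Qed.

Lemma rtocD (x y : R) : rtoc (x + y) = rtoc x + rtoc y.
Proof. exact: (rmorphD (real_complex R)). Qed.

Lemma rtocM (x y : R) : rtoc (x * y) = rtoc x * rtoc y.
Proof. exact: (rmorphM (real_complex R)). Qed.

Lemma rtocN (x : R) : rtoc (- x) = - rtoc x.
Proof. exact: (rmorphN (real_complex R)). Qed.

Lemma rtoc0 : rtoc (0 : R) = 0. Proof. by []. Qed.

Lemma rtoc1 : rtoc (1 : R) = 1. Proof. by []. Qed.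

Lemma rtocV (x : R) : rtoc x^-1 = (rtoc x)^-1.
Proof. exact: (fmorphV (real_complex R)). Qed.

Lemma rtoc_inj : injective (@rtoc R).
Proof. exact: complexI. Qed.

Lemma cn_rtoc (x : R) : cn (rtoc x) = `|x|.
Proof. by rewrite /cn /= expr0n addr0 sqrtr_sqr. Qed.

Lemma cn_ge0 z : 0 <= cn z.
Proof. by rewrite -rtoc_le -norm_cn normr_ge0. Qed.

Lemma cn_eq0 z : (cn z == 0) = (z == 0).
Proof. by rewrite -(inj_eq rtoc_inj) -norm_cn normr_eq0. Qed.

Lemma cn0 : cn (0 : C) = 0.
Proof. by apply/eqP; rewrite cn_eq0. Qed.

Lemma cn_gt0 z : (0 < cn z) = (z != 0).
Proof. by rewrite lt_def cn_ge0 andbT cn_eq0. Qed.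

Lemma cnM z w : cn (z * w) = cn z * cn w.
Proof. exact: ComplexField.Normc.normcM. Qed.

Lemma cnV z : cn z^-1 = (cn z)^-1.
Proof. exact: ComplexField.Normc.normcV. Qed.

Lemma cnX z n : cn (z ^+ n) = cn z ^+ n.
Proof.
elim: n => [|n ih]; last by rewrite !exprS cnM ih.
by rewrite !expr0 -[1 in LHS]rtoc1 cn_rtoc normr1.
Qed.

Lemma cnN z : cn (- z) = cn z.
Proof. by apply: rtoc_inj; rewrite -!norm_cn normrN. Qed.

Lemma cnB z w : cn (z - w) = cn (w - z).
Proof. by rewrite -cnN opprB. Qed.

Lemma cnD z w : cn (z + w) <= cn z + cn w.
Proof. by rewrite -rtoc_le rtocD -!norm_cn ler_normD. Qed.

Lemma cn_dist v z w : cn (z - w) <= cn (z - v) + cn (v - w).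
Proof. by apply: le_trans (cnD _ _); rewrite addrA subrK. Qed.

Lemma Re_le_cn z : `|complex.Re z| <= cn z.
Proof. by rewrite -rtoc_le -norm_cn; exact: normc_ge_Re. Qed.

Lemma Im_le_cn z : `|complex.Im z| <= cn z.
Proof.
case: z => a b /=; rewrite /cn /= -[X in X <= _]sqrtr_sqr ler_wsqrtr//.
by rewrite lerDr sqr_ge0.
Qed.

Lemma cn_le z : cn z <= `|complex.Re z| + `|complex.Im z|.
Proof.
case: z => a b /=; rewrite /cn /= -[X in _ <= X]ger0_norm ?addr_ge0//.
rewrite -sqrtr_sqr ler_wsqrtr// sqrrD !real_normK ?num_real//.
by rewrite -addrA lerD2l lerDr mulrn_wge0// mulr_ge0.
Qed.

End Modulus.

(** * Epsilon-delta forms of limits, continuity and complex differentiability *)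

Section Epsilon.
Variable R : realType.
Local Notation C := (Cplx R).
Implicit Types p z w : C.

(** In the order of [Cplx R] positive elements are real, so the radii of balls can be taken in
    [R]. *)
Lemma Cplx_gt0 (e : C) : 0 < e -> exists2 d : R, 0 < d & e = rtoc d.
Proof.
case: e => a b; rewrite ltcE /= => /andP[/eqP-> a0].
by exists a.
Qed.

Lemma nbhs_cnP p (P : set C) :
  nbhs p P <-> exists2 d : R, 0 < d & forall z, cn (z - p) < d -> P z.
Proof.
split.
  move=> /nbhs_ballP[e /= /Cplx_gt0[d d0 ->{e}]] H; exists d => // z zp.
  by apply: H; rewrite -ball_normE /= norm_cn rtoc_lt cnB.
move=> [d d0 H]; apply/nbhs_ballP; exists (rtoc d) => /=.
  by rewrite -rtoc0 rtoc_lt.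
move=> z; rewrite -ball_normE /= norm_cn rtoc_lt cnB; exact: H.
Qed.

Lemma cvg_cnP (T : Type) (F : set_system T) (FF : Filter F) (f : T -> C) l :
  f @ F --> l <-> forall e : R, 0 < e -> \forall x \near F, cn (f x - l) < e.
Proof.
split.
  move=> fl e e0; apply: (fl [set w | cn (w - l) < e]).
  by apply/nbhs_cnP; exists e.
move=> H P /nbhs_cnP[e e0 eP]; have := H _ e0.
by rewrite nbhs_simpl /=; apply: filterS => x /eP.
Qed.

Lemma continuous_cnP (f : C -> C) p : {for p, continuous f} <->
  forall e : R, 0 < e -> exists2 d : R, 0 < d &
    forall z, cn (z - p) < d -> cn (f z - f p) < e.
Proof.
split.
  move=> /(cvg_cnP (nbhs_filter p)) H e e0.
  exact: (nbhs_cnP p _).1 (H _ e0).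
move=> H; apply/(cvg_cnP (nbhs_filter p)) => e e0; apply/nbhs_cnP; exact: H.
Qed.

Lemma derive_cnP (f : C -> C) p l : is_derive p (1 : C) f l <->
  forall e : R, 0 < e -> exists2 d : R, 0 < d &
    forall z, cn (z - p) < d -> cn (f z - f p - l * (z - p)) <= e * cn (z - p).
Proof.
pose q := fun h : C => h^-1 *: (f (h *: (1 : C) + p) - f p).
have qE h : h != 0 -> f (h + p) - f p - l * h = h * (q h - l).
  move=> h0; rewrite /q.
  have -> : h *: (1 : C) = h by rewrite /GRing.scale /= mulr1.
  by rewrite /GRing.scale /= mulrBr mulrA divff// mul1r (mulrC h l).
have qP : q @ (0 : C)^' --> l <->
    forall e : R, 0 < e -> exists2 d : R, 0 < d &
    forall z, cn (z - p) < d -> cn (f z - f p - l * (z - p)) <= e * cn (z - p).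
  split.
    move=> /cvg_cnP H e e0.
    have /nbhs_cnP[d d0 Hd] : \forall h \near (0 : C), h != 0 -> cn (q h - l) < e.
      exact: H.
    exists d => // z zd; have [->|zp] := eqVneq z p.
      by rewrite !subrr mulr0 subrr !cn0 mulr0.
    have h0 : z - p != 0 by rewrite subr_eq0.
    have := qE _ h0; rewrite subrK => ->; rewrite cnM mulrC ler_wpM2r ?cn_ge0//.
    by apply/ltW/Hd => //; rewrite subr0.
  move=> H; apply/cvg_cnP => e e0.
  (* Halving [e] turns the non-strict bound into the strict one that the limit asks for. *)
  have e20 : 0 < e / 2 by rewrite divr_gt0.
  have [d d0 Hd] := H _ e20.
  suff : \forall h \near (0 : C), h != 0 -> cn (q h - l) < e by [].
  apply/nbhs_cnP; exists d => // h; rewrite subr0 => hd h0.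
  have := Hd (h + p); rewrite addrK => /(_ hd); rewrite qE// cnM mulrC.
  rewrite ler_pM2r ?cn_gt0// => /le_lt_trans; apply.
  by rewrite ltr_pdivrMr// ltr_pMr// ltr1n.
split.
  move=> [dq fl]; apply/qP; rewrite -fl; exact: dq.
move=> /qP ql; split; first by apply/cvg_ex; exists l.
exact: (cvg_lim (@norm_hausdorff _ _) ql).
Qed.

Lemma continuous_Re (p : C) : {for p, continuous (@complex.Re R : C -> R)}.
Proof.
apply/(cvgrPdist_lt (FF := nbhs_filter p)) => e e0.
apply/nbhs_cnP; exists e => // z ze.
apply: le_lt_trans ze; rewrite cnB; apply: le_trans (Re_le_cn _).
by case: p z => a b [c d].
Qed.

Lemma continuous_Im (p : C) : {for p, continuous (@complex.Im R : C -> R)}.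
Proof.
apply/(cvgrPdist_lt (FF := nbhs_filter p)) => e e0.
apply/nbhs_cnP; exists e => // z ze.
apply: le_lt_trans ze; rewrite cnB; apply: le_trans (Im_le_cn _).
by case: p z => a b [c d].
Qed.

End Epsilon.

(** * Integration of complex-valued functions on segments *)

Section ComplexIntegral.
Variable R : realType.
Local Notation C := (Cplx R).
Local Notation mu := (@lebesgue_measure R).
Implicit Types (F G : R -> C) (a b c : R).

Definition continuous_segment F a b :=
  forall x, a <= x <= b -> {for x, continuous F}.

(** Unoriented: for [b < a] the interval is empty and the value is 0, whence the hypotheses [a <= b]
    below. *)
Definition cint F a b : C :=
  Complex (\int[mu]_(x in `[a, b]) complex.Re (F x))
          (\int[mu]_(x in `[a, b]) complex.Im (F x)).


Lemma integrable_continuous (f : R -> R) a b :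
  (forall x, a <= x <= b -> {for x, continuous f}) ->
  mu.-integrable `[a, b] (EFin \o f).
Proof.
move=> H; apply: continuous_compact_integrable; first exact: segment_compact.
apply: continuous_in_subspaceT => x /set_mem/=.
by rewrite in_itv/=; exact: H.
Qed.

Lemma integrable_Re F a b : continuous_segment F a b ->
  mu.-integrable `[a, b] (EFin \o (fun x => complex.Re (F x))).
Proof.
move=> H; apply: integrable_continuous => x xab.
apply: (continuous_comp (f := F) (g := @complex.Re R)); first exact: H.
exact: continuous_Re.
Qed.

Lemma integrable_Im F a b : continuous_segment F a b ->
  mu.-integrable `[a, b] (EFin \o (fun x => complex.Im (F x))).
Proof.
move=> H; apply: integrable_continuous => x xab.
apply: (continuous_comp (f := F) (g := @complex.Im R)); first exact: H.
exact: continuous_Im.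
Qed.

Lemma eq_cint F G a b : (forall x, a <= x <= b -> F x = G x) ->
  cint F a b = cint G a b.
Proof.
move=> H; rewrite /cint; congr Complex; apply: eq_Rintegral => x /set_mem/=;
by rewrite in_itv/= => /H ->.
Qed.

Lemma cintD F G a b : continuous_segment F a b -> continuous_segment G a b ->
  cint (fun x => F x + G x) a b = cint F a b + cint G a b.
Proof.
move=> cF cG; rewrite {1}/cint.
rewrite (_ : (fun x => complex.Re (F x + G x)) =
             (fun x => complex.Re (F x) + complex.Re (G x))); last first.
  by apply/funext => x; case: (F x) (G x) => ? ? [].
rewrite (_ : (fun x => complex.Im (F x + G x)) =
             (fun x => complex.Im (F x) + complex.Im (G x))); last first.
  by apply/funext => x; case: (F x) (G x) => ? ? [].
by rewrite !RintegralD//; [exact: integrable_Im|exact: integrable_Im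
  |exact: integrable_Re|exact: integrable_Re].
Qed.

Lemma cintZ F k a b : continuous_segment F a b ->
  cint (fun x => k * F x) a b = k * cint F a b.
Proof.
case: k => p q cF; rewrite /cint.
have iR := integrable_Re cF; have iI := integrable_Im cF.
have iZ (r : R) (f : R -> R) : mu.-integrable `[a, b] (EFin \o f) ->
    mu.-integrable `[a, b] (EFin \o (fun x => r * f x)).
  move=> fi.
  have /= := @integrableZl _ _ _ mu `[a, b]%classic _ r _ fi.
  by apply; exact: measurable_itv.
rewrite (_ : (fun x => complex.Re (_ * F x)) =
  (fun x => p * complex.Re (F x) - q * complex.Im (F x))); last first.
  by apply/funext => x; case: (F x).
rewrite (_ : (fun x => complex.Im (_ * F x)) =
  (fun x => p * complex.Im (F x) + q * complex.Re (F x))); last first.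
  by apply/funext => x; case: (F x).
rewrite RintegralB//; [|exact: iZ|exact: iZ].
rewrite RintegralD//; [|exact: iZ|exact: iZ].
by rewrite !RintegralZl.
Qed.

Lemma cint_cst (k : C) a b : a <= b -> cint (fun=> k) a b = k * rtoc (b - a).
Proof.
move=> ab; case: k => p q; rewrite /cint /= !Rintegral_cst//=.
rewrite lebesgue_measure_itv/= lte_fin.
have -> : fine (if a < b then (b%:E - a%:E)%E else 0%E) = b - a.
  by move: ab; rewrite le_eqVlt => /predU1P[->|->]; rewrite ?ltxx ?subrr.
by apply/eqP; rewrite eq_complex /= !mulr0 subr0 add0r !eqxx.
Qed.

Lemma Rintegral_chasles (f : R -> R) a m b : a <= m -> m <= b ->
  mu.-integrable `[a, b] (EFin \o f) ->
  \int[mu]_(x in `[a, b]) f x =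
  \int[mu]_(x in `[a, m]) f x + \int[mu]_(x in `[m, b]) f x.
Proof.
move=> am mb fi; apply/eqP; rewrite addrC -subr_eq; apply/eqP.
(* The difference is an integral over an interval open at [m], and a point has measure 0. *)
rewrite (Rintegral_itvB fi) ?bnd_simp//.
rewrite Rintegral_itv_obnd_cbnd//; apply: integrableS fi => //.
by apply: subset_itvr; rewrite bnd_simp.
Qed.

Lemma cint_chasles F a m b : a <= m -> m <= b -> continuous_segment F a b ->
  cint F a b = cint F a m + cint F m b.
Proof.
move=> am mb cF; rewrite {1}/cint (Rintegral_chasles am mb (integrable_Re cF)).
by rewrite (Rintegral_chasles am mb (integrable_Im cF)).
Qed.

Lemma Rintegral_bound (f : R -> R) M a b : a <= b ->
  mu.-integrable `[a, b] (EFin \o f) ->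
  (forall x, a <= x <= b -> `|f x| <= M) ->
  `|\int[mu]_(x in `[a, b]) f x| <= M * (b - a).
Proof.
move=> ab fi fM; apply: le_trans (le_normr_Rintegral _ fi) _ => //.
have -> : M * (b - a) = \int[mu]_(x in `[a, b]) M.
  rewrite Rintegral_cst//= lebesgue_measure_itv/= lte_fin.
  by move: ab; rewrite le_eqVlt => /predU1P[->|->]; rewrite ?ltxx ?subrr.
apply: le_Rintegral => //.
- exact: (integrable_norm fi).
- by apply: integrable_continuous => x _; exact: cvg_cst.
Qed.

(** Real and imaginary parts are bounded separately, which costs the factor 2; the estimates below
    only ask for some absolute constant. *)
Lemma cint_bound F M a b : a <= b -> continuous_segment F a b ->
  (forall x, a <= x <= b -> cn (F x) <= M) ->
  cn (cint F a b) <= 2 * M * (b - a).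
Proof.
move=> ab cF FM; apply: le_trans (cn_le _) _.
rewrite -mulrA mulr2n mulrDl !mul1r; apply: lerD.
- apply: Rintegral_bound => //; first exact: integrable_Re.
  by move=> x /FM; apply: le_trans; exact: Re_le_cn.
- apply: Rintegral_bound => //; first exact: integrable_Im.
  by move=> x /FM; apply: le_trans; exact: Im_le_cn.
Qed.

End ComplexIntegral.

(** * Boundary integrals over rectangles *)

Section Boundary.
Variable R : realType.
Local Notation C := (Cplx R).
Implicit Types (f g : C -> C) (a b c d x y : R).

Definition Cpt x y : C := Complex x y.

Lemma CptB x y x' y' : Cpt x y - Cpt x' y' = Cpt (x - x') (y - y').
Proof. by []. Qed.

Lemma Cpt_ReIm (z : C) : z = Cpt (complex.Re z) (complex.Im z).
Proof. by case: z. Qed.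

Lemma CptE x y : Cpt x y = rtoc x + Cpt 0 1 * rtoc y.
Proof.
by apply/eqP; rewrite eq_complex /= !(mul0r, mul1r, subr0, addr0, add0r) !eqxx.
Qed.

Lemma cn_Cpt x y : cn (Cpt x y) <= `|x| + `|y|.
Proof. exact: cn_le. Qed.

Lemma cn_i : cn (Cpt 0 1) = 1.
Proof. by rewrite /cn /= expr0n expr1n add0r sqrtr1. Qed.

Lemma continuous_Cpt_l y x : {for x, continuous (fun t => Cpt t y)}.
Proof.
apply/(cvg_cnP (nbhs_filter x)) => e e0.
apply: filterS (@nbhsx_ballx _ R x e e0) => t.
move=> xt; suff : cn (Cpt t y - Cpt x y) < e by [].
rewrite CptB subrr; apply: le_lt_trans (cn_Cpt _ _) _.
by rewrite normr0 addr0 distrC.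
Qed.

Lemma continuous_Cpt_r x y : {for y, continuous (fun t => Cpt x t)}.
Proof.
apply/(cvg_cnP (nbhs_filter y)) => e e0.
apply: filterS (@nbhsx_ballx _ R y e e0) => t.
move=> xt; suff : cn (Cpt x t - Cpt x y) < e by [].
rewrite CptB subrr; apply: le_lt_trans (cn_Cpt _ _) _.
by rewrite normr0 add0r distrC.
Qed.

(** The contour integral of [f dz], counterclockwise around the rectangle with corners [(a, c)] and
    [(b, d)]. Opposite sides are paired, with [dz = dx] on the horizontal ones and [dz = i dy] on
    the vertical ones. *)
Definition boundary f a b c d : C :=
  cint (fun x => f (Cpt x c) - f (Cpt x d)) a b
  + Cpt 0 1 * cint (fun y => f (Cpt b y) - f (Cpt a y)) c d.

Definition on_boundary a b c d (P : C -> Prop) : Prop :=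
  (forall x, a <= x <= b -> P (Cpt x c) /\ P (Cpt x d)) /\
  (forall y, c <= y <= d -> P (Cpt a y) /\ P (Cpt b y)).

Definition boundary_continuous f a b c d :=
  on_boundary a b c d (fun z => {for z, continuous f}).

Lemma on_boundaryW a b c d (P Q : C -> Prop) : (forall z, P z -> Q z) ->
  on_boundary a b c d P -> on_boundary a b c d Q.
Proof.
by move=> PQ [h v]; split=> t tI;
  [have [] := h t tI | have [] := v t tI]; move=> /PQ ? /PQ.
Qed.

Lemma on_boundaryI a b c d (P Q : C -> Prop) :
  on_boundary a b c d P -> on_boundary a b c d Q ->
  on_boundary a b c d (fun z => P z /\ Q z).
Proof.
by move=> [h v] [h' v']; split=> t tI; move: (tI);
  [move=> /h[? ?] | move=> /v[? ?]]; move: tI; [move=> /h'[] | move=> /v'[]].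
Qed.

Lemma on_boundary_rect a b c d (P : C -> Prop) : a <= b -> c <= d ->
  (forall x y, a <= x <= b -> c <= y <= d -> P (Cpt x y)) ->
  on_boundary a b c d P.
Proof.
by move=> ab cd H; split=> t tI; split; apply: H; rewrite ?lexx ?ab ?cd.
Qed.

Lemma boundary_continuous_h f a b c d : boundary_continuous f a b c d ->
  continuous_segment (fun x => f (Cpt x c) - f (Cpt x d)) a b.
Proof.
move=> [h _] x /h[fc fd]; apply: cvgB.
- exact: (@continuous_comp _ _ _ (fun t => Cpt t c) f x (@continuous_Cpt_l c x) fc).
- exact: (@continuous_comp _ _ _ (fun t => Cpt t d) f x (@continuous_Cpt_l d x) fd).
Qed.

Lemma boundary_continuous_v f a b c d : boundary_continuous f a b c d ->
  continuous_segment (fun y => f (Cpt b y) - f (Cpt a y)) c d.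
Proof.
move=> [_ v] y /v[fa fb]; apply: cvgB.
- exact: (@continuous_comp _ _ _ (fun t => Cpt b t) f y (@continuous_Cpt_r b y) fb).
- exact: (@continuous_comp _ _ _ (fun t => Cpt a t) f y (@continuous_Cpt_r a y) fa).
Qed.

Lemma eq_boundary f g a b c d : on_boundary a b c d (fun z => f z = g z) ->
  boundary f a b c d = boundary g a b c d.
Proof.
move=> [h v]; rewrite /boundary.
by congr (_ + _ * _); apply: eq_cint => t; [move=> /h | move=> /v] => -[-> ->].
Qed.

Lemma boundaryD f g a b c d :
  boundary_continuous f a b c d -> boundary_continuous g a b c d ->
  boundary (fun z => f z + g z) a b c d = boundary f a b c d + boundary g a b c d.
Proof.
move=> cf cg; rewrite /boundary addrACA -mulrDr.
rewrite -(cintD (boundary_continuous_h cf) (boundary_continuous_h cg)).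
rewrite -(cintD (boundary_continuous_v cf) (boundary_continuous_v cg)).
by congr (_ + _ * _); apply: eq_cint => t _; rewrite opprD addrACA.
Qed.

Lemma boundaryZ f (k : C) a b c d : boundary_continuous f a b c d ->
  boundary (fun z => k * f z) a b c d = k * boundary f a b c d.
Proof.
move=> cf; rewrite /boundary mulrDr (mulrCA k).
rewrite -(cintZ _ (boundary_continuous_h cf)) -(cintZ _ (boundary_continuous_v cf)).
by congr (_ + _ * _); apply: eq_cint => t _; rewrite mulrBr.
Qed.

(** One factor 2 comes from pairing opposite sides, the other from [cint_bound]. *)
Lemma boundary_bound f M a b c d : a <= b -> c <= d ->
  boundary_continuous f a b c d -> on_boundary a b c d (fun z => cn (f z) <= M) ->
  cn (boundary f a b c d) <= 4 * M * ((b - a) + (d - c)).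
Proof.
move=> ab cd cf [h v]; rewrite mulrDr; apply: le_trans (cnD _ _) _.
have E u w : cn (f u) <= M -> cn (f w) <= M -> cn (f u - f w) <= 2 * M.
  move=> uM wM; apply: le_trans (cnD _ _) _.
  by rewrite cnN mulr2n mulrDl mul1r lerD.
rewrite cnM cn_i mul1r (_ : 4 * M = 2 * (2 * M)); last by ring.
apply: lerD; apply: cint_bound => //.
- exact: boundary_continuous_h.
- by move=> x /h[]; exact: E.
- exact: boundary_continuous_v.
- by move=> x /v[] ? ?; exact: E.
Qed.

(** Between opposite sides an affine function differs by a constant, and the contributions of the
    two pairs cancel. *)
Lemma boundary_affine (k l : C) a b c d : a <= b -> c <= d ->
  boundary (fun z => k + l * z) a b c d = 0.
Proof.
move=> ab cd; rewrite /boundary.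
have aff u w : k + l * u - (k + l * w) = l * (u - w) by ring.
rewrite (@eq_cint _ _ (fun=> l * Cpt 0 (c - d))); last first.
  by move=> x _; rewrite aff CptB subrr.
rewrite (@eq_cint _ _ (fun=> l * Cpt (b - a) 0) c d); last first.
  by move=> y _; rewrite aff CptB subrr.
rewrite !cint_cst// (CptE 0 (c - d)) (_ : Cpt (b - a) 0 = rtoc (b - a))//.
rewrite rtoc0 !rtocD !rtocN; ring.
Qed.

(** The common side [x = m] is traversed in both directions. *)
Lemma boundary_splitx f a m b c d : a <= m -> m <= b ->
  boundary_continuous f a m c d -> boundary_continuous f m b c d ->
  boundary f a b c d = boundary f a m c d + boundary f m b c d.
Proof.
move=> am mb c1 c2; rewrite /boundary (cint_chasles am mb); last first.
  move=> x /andP[ax xb]; have [xm|/ltW mx] := leP x m.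
    by apply: (boundary_continuous_h c1); rewrite ax.
  by apply: (boundary_continuous_h c2); rewrite mx.
rewrite addrACA -mulrDr -(cintD (boundary_continuous_v c1) (boundary_continuous_v c2)).
by congr (_ + _ * _); apply: eq_cint => t _; ring.
Qed.

Lemma boundary_splity f a b c m d : c <= m -> m <= d ->
  boundary_continuous f a b c m -> boundary_continuous f a b m d ->
  boundary f a b c d = boundary f a b c m + boundary f a b m d.
Proof.
move=> am mb c1 c2; rewrite /boundary (cint_chasles am mb); last first.
  move=> x /andP[ax xb]; have [xm|/ltW mx] := leP x m.
    by apply: (boundary_continuous_v c1); rewrite ax.
  by apply: (boundary_continuous_v c2); rewrite mx.
rewrite mulrDr addrACA -(cintD (boundary_continuous_h c1) (boundary_continuous_h c2)).
by congr (_ + _); apply: eq_cint => t _; ring.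
Qed.

End Boundary.

(** * Repeated bisection of rectangles *)

Section Bisection.
Variable R : realType.
Implicit Types (a b c d x y : R).

Lemma nested_intervals (a_ b_ : nat -> R) :
  (forall n, a_ n <= a_ n.+1) -> (forall n, b_ n.+1 <= b_ n) ->
  (forall n, a_ n <= b_ n) -> exists p, forall n, a_ n <= p <= b_ n.
Proof.
move=> ia db ab.
have am m n : (m <= n)%N -> a_ m <= a_ n.
  by move: m n; exact/nondecreasing_seqP.
have bm m n : (m <= n)%N -> b_ n <= b_ m.
  by move: m n; exact/nonincreasing_seqP.
have amb m n : a_ m <= b_ n.
  by rewrite (le_trans (am _ _ (leq_maxl m n)))// (le_trans (ab _))// bm// leq_maxr.
exists (sup (range a_)) => n; apply/andP; split.
  by apply: ub_le_sup; [exists (b_ 0) => _ [m _ <-] | exists n].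
by apply: ge_sup; [exists (a_ 0); exists 0%N | move=> _ [m _ <-]].
Qed.

(* The rectangles are kept ordered and inside the initial one, so that [P] need
   only be controlled there. *)
Lemma bisection (P : R -> R -> R -> R -> Prop) a0 b0 c0 d0 :
  a0 <= b0 -> c0 <= d0 ->
  (forall a b c d, a0 <= a -> a <= b -> b <= b0 -> c0 <= c -> c <= d -> d <= d0 ->
    P a ((a + b) / 2) c ((c + d) / 2) -> P ((a + b) / 2) b c ((c + d) / 2) ->
    P a ((a + b) / 2) ((c + d) / 2) d -> P ((a + b) / 2) b ((c + d) / 2) d ->
    P a b c d) ->
  (forall p q, a0 <= p <= b0 -> c0 <= q <= d0 -> exists2 e : R, 0 < e &
    forall a b c d, a0 <= a -> a <= p -> p <= b -> b <= b0 ->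
      c0 <= c -> c <= q -> q <= d -> d <= d0 ->
      (b - a) + (d - c) < e -> P a b c d) ->
  P a0 b0 c0 d0.
Proof.
move=> ab0 cd0 Hsplit Hloc; apply: contrapT => nP0.
pose T := (R * R * R * R)%type.
pose good (s : T) := let: (a, b, c, d) := s in
  [/\ [/\ a0 <= a, a <= b & b <= b0], [/\ c0 <= c, c <= d & d <= d0] & ~ P a b c d].
(* The last clause halves [(b - a) + (d - c)], so the nested rectangles shrink to a point. *)
pose sub (s t : T) := let: (a, b, c, d) := s in let: (a', b', c', d') := t in
  [/\ a <= a', b' <= b, c <= c', d' <= d &
      (b' - a') + (d' - c') = ((b - a) + (d - c)) / 2].
have step s : good s -> {t | good t /\ sub s t}.
  move=> gs; apply: cid; move: s gs => [[[a b] c] d] [[aa ab bb] [cc cd dd] nP].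
  have am : a <= (a + b) / 2 by lra.
  have mb : (a + b) / 2 <= b by lra.
  have cm : c <= (c + d) / 2 by lra.
  have md : (c + d) / 2 <= d by lra.
  (* If [P] held on all four quarters it would hold on the rectangle; hence it fails on some
     quarter. *)
  apply: contrapT => H; apply: nP; apply: Hsplit => //; apply: contrapT => nP; apply: H.
  - exists (a, (a + b) / 2, c, (c + d) / 2); split; first by split=> //; split=> //; lra.
    by split=> //; lra.
  - exists ((a + b) / 2, b, c, (c + d) / 2); split; first by split=> //; split=> //; lra.
    by split=> //; lra.
  - exists (a, (a + b) / 2, (c + d) / 2, d); split; first by split=> //; split=> //; lra.
    by split=> //; lra.
  - exists ((a + b) / 2, b, (c + d) / 2, d); split; first by split=> //; split=> //; lra.
    by split=> //; lra.
have g0 : good (a0, b0, c0, d0) by [].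
pose next (s : {s | good s}) : {s | good s} :=
  exist _ (sval (step _ (svalP s))) (svalP (step _ (svalP s))).1.
pose u n := iter n next (exist _ _ g0).
have usub n : sub (sval (u n)) (sval (u n.+1)).
  by rewrite /u iterS /= ; case: (step _ _) => t [? ?].
have ugood n : good (sval (u n)) by exact: svalP.
pose a_ n := (sval (u n)).1.1.1; pose b_ n := (sval (u n)).1.1.2.
pose c_ n := (sval (u n)).1.2; pose d_ n := (sval (u n)).2.
have uE n : sval (u n) = (a_ n, b_ n, c_ n, d_ n).
  by rewrite /a_ /b_ /c_ /d_; case: (sval (u n)) => [[[]]].
have {}ugood n : good (a_ n, b_ n, c_ n, d_ n) by rewrite -uE.
have {}usub n : sub (a_ n, b_ n, c_ n, d_ n) (a_ n.+1, b_ n.+1, c_ n.+1, d_ n.+1).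
  by rewrite -!uE.
have [|||p pP] := @nested_intervals a_ b_.
- by move=> n; have [] := usub n.
- by move=> n; have [] := usub n.
- by move=> n; have [[]] := ugood n.
have [|||q qP] := @nested_intervals c_ d_.
- by move=> n; have [] := usub n.
- by move=> n; have [] := usub n.
- by move=> n; have [_ []] := ugood n.
have [||e e0 He] := Hloc p q; [exact: (pP 0%N) | exact: (qP 0%N) |].
have size n : (b_ n - a_ n) + (d_ n - c_ n) = ((b0 - a0) + (d0 - c0)) / 2 ^+ n.
  elim: n => [|n ih]; first by rewrite expr0 divr1.
  have [_ _ _ _ ->] := usub n; rewrite ih exprS invfM; ring.
(* By the archimedean property and [n < 2 ^ n]. *)
have [n sn] : exists n : nat, ((b0 - a0) + (d0 - c0)) / 2 ^+ n < e.
  have := archi_boundP (x := ((b0 - a0) + (d0 - c0)) / e).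
  rewrite divr_ge0 ?(ltW e0)//; last by rewrite addr_ge0 // subr_ge0.
  move: (Num.bound _) => n /(_ isT) H; exists n.
  rewrite ltr_pdivrMr ?exprn_gt0// mulrC -ltr_pdivrMr//.
  by apply: lt_le_trans H _; rewrite -natrX ler_nat ltnW// ltn_expl.
have [[? ? ?] [? ? ?] nP] := ugood n; apply: nP.
have /andP[? ?] := pP n; have /andP[? ?] := qP n.
by apply: He => //; rewrite size.
Qed.

End Bisection.

(** * Goursat's theorem and a Cauchy estimate *)

Section Cauchy.
Variable R : realType.
Local Notation C := (Cplx R).
Implicit Types (f g : C -> C) (a b c d x y : R).

Lemma derivable_continuous f (z : C) : derivable f z 1 -> {for z, continuous f}.
Proof. by move=> /derivable1_diffP/differentiable_continuous. Qed.

Lemma le_eps (u K : R) : 0 <= K -> (forall e, 0 < e -> u <= e * K) -> u <= 0.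
Proof.
move=> K0 H; apply/ler_addgt0Pr => e e0; rewrite add0r.
(* [K] may be 0, so [e] is divided by [K + 1]. *)
have K1 : 0 < K + 1 by rewrite ltr_wpDl.
apply: le_trans (H _ (divr_gt0 e0 K1)) _.
by rewrite -mulrA ler_piMr ?(ltW e0)// mulrC ler_pdivrMr// mul1r lerDl.
Qed.

(** With [L] the half-perimeter, the bound by [e * L ^+ 2] passes from the quarters to the whole. It
    holds on small rectangles around a point, because [f] differs there from an affine function,
    whose boundary integral is 0, by at most a small multiple of [L]. *)
Lemma goursat f a b c d : a <= b -> c <= d ->
  (forall x y, a <= x <= b -> c <= y <= d -> derivable f (Cpt x y) 1) ->
  boundary f a b c d = 0.
Proof.
move=> ab cd df; apply/eqP; rewrite -cn_eq0 eq_le cn_ge0 andbT.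
have cf a' b' c' d' : a <= a' -> a' <= b' -> b' <= b ->
    c <= c' -> c' <= d' -> d' <= d -> boundary_continuous f a' b' c' d'.
  move=> aa ab' bb cc cd' dd; apply: on_boundary_rect => //.
  move=> x y /andP[ax xb] /andP[cy yd]; apply/derivable_continuous/df.
    by rewrite (le_trans aa) // (le_trans xb).
  by rewrite (le_trans cc) // (le_trans yd).
apply: (@le_eps _ (((b - a) + (d - c)) ^+ 2)); first exact: sqr_ge0.
move=> e e0.
apply: (bisection (P := fun a b c d =>
  cn (boundary f a b c d) <= e * ((b - a) + (d - c)) ^+ 2)) => //.
  move=> a' b' c' d' aa ab' bb cc cd' dd.
  have am : a' <= (a' + b') / 2 by lra.
  have mb : (a' + b') / 2 <= b' by lra.
  have cm : c' <= (c' + d') / 2 by lra.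
  have md : (c' + d') / 2 <= d' by lra.
  move: am mb cm md; set m := (a' + b') / 2; set n := (c' + d') / 2.
  move=> am mb cm md P1 P2 P3 P4.
  have am0 := le_trans aa am; have mb0 := le_trans mb bb.
  have cm0 := le_trans cc cm; have md0 := le_trans md dd.
  have cf1 x y := cf _ _ x y aa am mb0; have cf2 x y := cf _ _ x y am0 mb bb.
  have cf3 x y := cf _ _ x y aa ab' bb.
  rewrite (boundary_splity cm md (cf3 _ _ cc cm md0) (cf3 _ _ cm0 md dd)).
  rewrite (boundary_splitx am mb (cf1 _ _ cc cm md0) (cf2 _ _ cc cm md0)).
  rewrite (boundary_splitx am mb (cf1 _ _ cm0 md dd) (cf2 _ _ cm0 md dd)).
  apply: le_trans (cnD _ _) _; apply: le_trans (lerD (cnD _ _) (cnD _ _)) _.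
  apply: le_trans (lerD (lerD P1 P2) (lerD P3 P4)) _.
  (* Each quarter has half-perimeter [L / 2], and [4 (L / 2)^2 = L^2]. *)
  rewrite -!mulrDr ler_pM2l// le_eqVlt; apply/orP; left; apply/eqP.
  by rewrite /m /n; field.
move=> p q pI qI.
(* The division by 4 absorbs the constant of [boundary_bound]. *)
have [l /derive_cnP/(_ (e / 4))] : exists l, is_derive (Cpt p q) 1 f l.
  by exists ('D_1 f (Cpt p q)); apply/derivableP/df.
case; first by rewrite divr_gt0.
move=> r r0 Hr; exists r => // a' b' c' d' aa ap pb bb cc cq qd dd Lr.
have ab' := le_trans ap pb; have cd' := le_trans cq qd.
pose k := f (Cpt p q) - l * Cpt p q.
pose g z := f z - (k + l * z).
have caff : boundary_continuous (fun z => k + l * z) a' b' c' d'.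
  apply: on_boundary_rect => // x y _ _; apply: continuousD; first exact: cst_continuous.
  by apply: continuousM; [exact: cst_continuous | exact: (@cvg_id C)].
have cg : boundary_continuous g a' b' c' d'.
  have := on_boundaryI (cf _ _ _ _ aa ab' bb cc cd' dd) caff.
  by apply: on_boundaryW => z [fz gz]; exact: (cvgB fz gz).
have -> : boundary f a' b' c' d' = boundary g a' b' c' d'.
  rewrite -[RHS]addr0 -(boundary_affine k l ab' cd') -boundaryD//.
  by apply: eq_boundary; apply: on_boundary_rect => // x y _ _; rewrite /g subrK.
set L := b' - a' + (d' - c') in Lr *.
have L0 : 0 <= L by rewrite /L; lra.
have -> : e * L ^+ 2 = 4 * (e / 4 * L) * L by field.
apply: boundary_bound => //; apply: on_boundary_rect => // x y /andP[ax xb] /andP[cy yd].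
have zL : cn (Cpt x y - Cpt p q) <= L.
  rewrite CptB; apply: le_trans (cn_Cpt _ _) _.
  by apply: lerD; rewrite ler_norml; lra.
have -> : g (Cpt x y) = f (Cpt x y) - f (Cpt p q) - l * (Cpt x y - Cpt p q).
  by rewrite /g /k; ring.
apply: le_trans (Hr _ (le_lt_trans zL Lr)) _.
by rewrite ler_wpM2l// divr_ge0// ltW.
Qed.

Lemma Rintegral_ge (h : R -> R) m a b : a <= b ->
  (forall x, a <= x <= b -> {for x, continuous h}) ->
  (forall x, a <= x <= b -> m <= h x) ->
  m * (b - a) <= \int[@lebesgue_measure R]_(x in `[a, b]) h x.
Proof.
move=> ab hc hm.
have -> : m * (b - a) = \int[@lebesgue_measure R]_(x in `[a, b]) m.
  rewrite Rintegral_cst//= lebesgue_measure_itv/= lte_fin.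
  by move: ab; rewrite le_eqVlt => /predU1P[->|->]; rewrite ?ltxx ?subrr.
apply: le_Rintegral => //.
- by apply: integrable_continuous => x _; exact: cvg_cst.
- exact: integrable_continuous.
Qed.

(** As [|x - x0| <= s], the denominator is at most [2 s^2]; the integrand is thus at least [1 / s]
    on an interval of length [2 s]. *)
Lemma kernel_Rintegral (x0 s : R) : 0 < s ->
  2 <= \int[@lebesgue_measure R]_(x in `[x0 - s, x0 + s])
         (2 * s / ((x - x0) ^+ 2 + s ^+ 2)).
Proof.
move=> s0; have s20 : 0 < s ^+ 2 by rewrite exprn_gt0.
have D0 x : 0 < (x - x0) ^+ 2 + s ^+ 2 by rewrite ltr_wpDl ?sqr_ge0.
rewrite [X in X <= _](_ : 2 = s^-1 * (x0 + s - (x0 - s))); last first.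
  by field; rewrite gt_eqF.
apply: Rintegral_ge; first lra.
  move=> x _; apply: cvgM; first exact: cvg_cst.
  apply: cvgV; first by rewrite gt_eqF.
  apply: cvgD; last exact: cvg_cst.
  by apply: cvgM; (apply: cvgB; [exact: cvg_id|exact: cvg_cst]).
move=> x /andP[ax xb].
rewrite ler_pdivlMr// mulrC ler_pdivrMr//.
have : 0 <= (s - (x - x0)) * (s + (x - x0)) by apply: mulr_ge0; lra.
nra.
Qed.

End Cauchy.

(** * The Cauchy estimate on a square *)

Section CauchyBound.
Variable R : realType.
Local Notation C := (Cplx R).
Implicit Types (f g : C -> C) (s : R).

(** Pairing opposite sides leaves [i] times the sum of two integrals of the kernel, each at least 2.
    This lower bound stands in for the exact value [2 pi i]. *)
Lemma boundary_kernel (z0 : C) s : 0 < s ->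
  4 <= cn (boundary (fun z => (z - z0)^-1) (complex.Re z0 - s)
    (complex.Re z0 + s) (complex.Im z0 - s) (complex.Im z0 + s)).
Proof.
move=> s0; pose x0 := complex.Re z0; pose y0 := complex.Im z0.
rewrite -/x0 -/y0; set k := boundary _ _ _ _ _.
pose h (t0 t : R) : R := 2 * s / ((t - t0) ^+ 2 + s ^+ 2).
have D0 t : t ^+ 2 + s ^+ 2 != 0.
  by rewrite gt_eqF// ltr_wpDl ?sqr_ge0// exprn_gt0.
have kE : k = Complex 0 (\int[@lebesgue_measure R]_(x in `[x0 - s, x0 + s]) h x0 x
      + \int[@lebesgue_measure R]_(x in `[y0 - s, y0 + s]) h y0 x).
  rewrite /k /boundary.
  rewrite (@eq_cint _ _ (fun x => Complex 0 (h x0 x))); last first.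
    move=> x _; rewrite (Cpt_ReIm z0) -/x0 -/y0 !CptB.
    have -> : y0 - s - y0 = - s by ring.
    have -> : y0 + s - y0 = s by ring.
    apply/eqP; rewrite eq_complex /= sqrrN subrr eqxx/= /h; apply/eqP.
    by move: (_ + _)^-1 => n; ring.
  rewrite (@eq_cint _ _ (fun y => Complex (h y0 y) 0) (y0 - s)); last first.
    move=> y _; rewrite (Cpt_ReIm z0) -/x0 -/y0 !CptB.
    have -> : x0 - s - x0 = - s by ring.
    have -> : x0 + s - x0 = s by ring.
    apply/eqP; rewrite eq_complex /= sqrrN /h; apply/andP; split; apply/eqP.
      by rewrite [(y - y0) ^+ 2 + _]addrC; move: (_ + _)^-1 => n; ring.
    by ring.
  rewrite /cint /= !Rintegral_cst//=.
  by apply/eqP; rewrite eq_complex /= !mul0r mulr0 subrr addr0 mul1r add0r !eqxx.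
apply: le_trans (Im_le_cn _); rewrite kE /=; apply: le_trans (ler_norm _).
by have := kernel_Rintegral x0 s0; have := kernel_Rintegral y0 s0; rewrite /h; lra.
Qed.

(** On the square of half-side [s], [f z / (z - z0)] is the difference quotient [g z], of boundary
    integral 0, plus [f z0 / (z - z0)]. Its boundary integral is therefore at least [4 |f z0|] in
    modulus, and at most [16 M] since the boundary lies in the ring where [|f| <= M]. *)
Lemma cauchy_bound f (z0 : C) s M : 0 < s ->
  (forall z, cn (z - z0) <= 2 * s -> derivable f z 1) ->
  (forall z, s <= cn (z - z0) <= 2 * s -> cn (f z) <= M) ->
  cn (f z0) <= 4 * M.
Proof.
move=> s0 df fM.
pose x0 := complex.Re z0; pose y0 := complex.Im z0.
(* At [z0] division by zero gives the value 0; the contours and the Goursat rectangles avoid that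
   point. *)
pose g z := (f z - f z0) / (z - z0).
have inj2 x y r : `|x - x0| <= r -> `|y - y0| <= r -> cn (Cpt x y - z0) <= 2 * r.
  move=> xr yr; rewrite (Cpt_ReIm z0) CptB; apply: le_trans (cn_Cpt _ _) _.
  by rewrite mulr2n mulrDl mul1r lerD.
have dg z : cn (z - z0) <= 2 * s -> z != z0 -> derivable g z 1.
  move=> zs zz0; apply: derivableM; first by apply: derivableB; [exact: df|exact: derivable_cst].
  apply: derivableV; first by rewrite subr_eq0.
  by apply: derivableB; [exact: derivable_id|exact: derivable_cst].
have on_sq r : 0 < r -> on_boundary (x0 - r) (x0 + r) (y0 - r) (y0 + r)
    (fun z => r <= cn (z - z0) <= 2 * r).
  move=> r0; split=> t /andP[t1 t2]; (have tr t0 : t0 - r <= t -> t <= t0 + r -> `|t - t0| <= r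
    by rewrite ler_norml; lra); split; apply/andP; split.
  - apply: le_trans (Im_le_cn _); rewrite (Cpt_ReIm z0) CptB /= -/y0.
    by rewrite (_ : y0 - r - y0 = - r) ?normrN ?ger0_norm ?(ltW r0)//; ring.
  - by apply: inj2; [exact: tr | rewrite ler_norml; lra].
  - apply: le_trans (Im_le_cn _); rewrite (Cpt_ReIm z0) CptB /= -/y0.
    by rewrite (_ : y0 + r - y0 = r) ?ger0_norm ?(ltW r0)//; ring.
  - by apply: inj2; [exact: tr | rewrite ler_norml; lra].
  - apply: le_trans (Re_le_cn _); rewrite (Cpt_ReIm z0) CptB /= -/x0.
    by rewrite (_ : x0 - r - x0 = - r) ?normrN ?ger0_norm ?(ltW r0)//; ring.
  - by apply: inj2; [rewrite ler_norml; lra | exact: tr].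
  - apply: le_trans (Re_le_cn _); rewrite (Cpt_ReIm z0) CptB /= -/x0.
    by rewrite (_ : x0 + r - x0 = r) ?ger0_norm ?(ltW r0)//; ring.
  - by apply: inj2; [rewrite ler_norml; lra | exact: tr].
have ne_z0 r z : 0 < r -> r <= cn (z - z0) -> z != z0.
  by move=> r0 rz; rewrite -subr_eq0 -cn_gt0; exact: lt_le_trans rz.
pose B r := boundary g (x0 - r) (x0 + r) (y0 - r) (y0 + r).
have cB r : 0 < r -> r <= s ->
    boundary_continuous g (x0 - r) (x0 + r) (y0 - r) (y0 + r).
  move=> r0 rs; apply: on_boundaryW (on_sq r r0) => z /andP[z1 z2].
  apply/derivable_continuous/dg; last exact: (ne_z0 r).
  by apply: le_trans z2 _; rewrite ler_pM2l.
(* The region between the concentric squares is cut into four rectangles that avoid [z0]: two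
   full-height strips at the left and right, and two short ones below and above the inner square.
   Goursat's theorem applies to each. *)
have Bs r : 0 < r -> r <= s -> B s = B r.
  move=> r0 rs.
  have cg x y : `|x - x0| <= s -> `|y - y0| <= s -> r <= `|x - x0| \/ r <= `|y - y0| ->
      derivable g (Cpt x y) 1.
    move=> xs ys xy; apply: dg; first exact: inj2.
    apply: (ne_z0 r) => //; rewrite (Cpt_ReIm z0) CptB; case: xy => /le_trans; apply.
      exact: le_trans (Re_le_cn _).
    exact: le_trans (Im_le_cn _).
  have rect a b c d : x0 - s <= a -> a <= b -> b <= x0 + s ->
      y0 - s <= c -> c <= d -> d <= y0 + s ->
      [\/ b <= x0 - r, x0 + r <= a, d <= y0 - r | y0 + r <= c] ->
      boundary g a b c d = 0 /\ boundary_continuous g a b c d.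
    move=> sa ab bs sc cd ds H.
    have dgr x y : a <= x <= b -> c <= y <= d -> derivable g (Cpt x y) 1.
      move=> /andP[ax xb] /andP[cy yd]; apply: cg.
      - by rewrite ler_norml; lra.
      - by rewrite ler_norml; lra.
      - case: H => H; [left|left|right|right]; rewrite ler_normr; apply/orP;
          [right|left|right|left]; lra.
    split; first exact: goursat.
    by apply: (on_boundary_rect ab cd) => x y xI yI; exact/derivable_continuous/dgr.
  have e1 : x0 - s <= x0 - r by lra.
  have e2 : x0 - r <= x0 + r by lra.
  have e3 : x0 + r <= x0 + s by lra.
  have e4 : y0 - s <= y0 - r by lra.
  have e5 : y0 - r <= y0 + r by lra.
  have e6 : y0 + r <= y0 + s by lra.
  have [b1 c1] : boundary g (x0 - s) (x0 - r) (y0 - s) (y0 + s) = 0 /\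
      boundary_continuous g (x0 - s) (x0 - r) (y0 - s) (y0 + s).
    by apply: rect; [lra..| constructor 1].
  have [b2 c2] : boundary g (x0 + r) (x0 + s) (y0 - s) (y0 + s) = 0 /\
      boundary_continuous g (x0 + r) (x0 + s) (y0 - s) (y0 + s).
    by apply: rect; [lra..| constructor 2].
  have [b3 c3] : boundary g (x0 - r) (x0 + r) (y0 - s) (y0 - r) = 0 /\
      boundary_continuous g (x0 - r) (x0 + r) (y0 - s) (y0 - r).
    by apply: rect; [lra..| constructor 3].
  have [b4 c4] : boundary g (x0 - r) (x0 + r) (y0 + r) (y0 + s) = 0 /\
      boundary_continuous g (x0 - r) (x0 + r) (y0 + r) (y0 + s).
    by apply: rect; [lra..| constructor 4].
  have c5 := cB _ r0 rs.
  have glue_y a b c m d : boundary_continuous g a b c m -> boundary_continuous g a b m d ->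
      boundary_continuous g a b c d.
    move=> [h1 v1] [h2 v2]; split=> t tI.
      by split; [exact: (h1 t tI).1 | exact: (h2 t tI).2].
    by have [tm|/ltW mt] := leP t m; [apply: v1 | apply: v2]; lra.
  have glue_x a m b c d : boundary_continuous g a m c d -> boundary_continuous g m b c d ->
      boundary_continuous g a b c d.
    move=> [h1 v1] [h2 v2]; split=> t tI; last first.
      by split; [exact: (v1 t tI).1 | exact: (v2 t tI).2].
    by have [tm|/ltW mt] := leP t m; [apply: h1 | apply: h2]; lra.
  (* Continuity along the sides of the partial unions, built outwards from the inner square, as the
     successive splittings require. *)
  have c35 := glue_y _ _ _ _ _ c3 c5; have c354 := glue_y _ _ _ _ _ c35 c4.
  have c3542 := glue_x _ _ _ _ _ c354 c2.
  rewrite /B (boundary_splitx e1 (le_trans e2 e3) c1 c3542) b1 add0r.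
  rewrite (boundary_splitx e2 e3 c354 c2) b2 addr0.
  rewrite (boundary_splity (le_trans e4 e5) e6 c35 c4) b4 addr0.
  by rewrite (boundary_splity e4 e5 c3 c5) b3 add0r.
(* Near [z0] the quotient [g] is bounded by [|f'(z0)| + 1], so [B r] is of the order of [r], while
   it equals [B s] for every small [r]. *)
have B0 : B s = 0.
  have [l /derive_cnP/(_ 1 ltr01)[d d0 Hd]] : exists l, is_derive z0 1 f l.
    exists ('D_1 f z0); apply/derivableP/df.
    by rewrite subrr cn0 mulr_ge0// ltW.
  pose K := cn l + 1.
  have K0 : 0 <= K by rewrite addr_ge0 ?cn_ge0.
  have gK z : z != z0 -> cn (z - z0) < d -> cn (g z) <= K.
    move=> zz0 zd; rewrite /g cnM cnV ler_pdivrMr ?cn_gt0 ?subr_eq0//.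
    have := cnD (f z - f z0 - l * (z - z0)) (l * (z - z0)).
    rewrite subrK => /le_trans; apply; rewrite /K mulrDl addrC cnM lerD2l.
    exact: Hd.
  apply/eqP; rewrite -cn_eq0 eq_le cn_ge0 andbT.
  apply: (@le_eps _ _ (16 * K)); first by rewrite mulr_ge0.
  (* The bound [d / 3] ensures [2 * r < d], so the contour stays where [g] is controlled. *)
  move=> e e0; pose r := Num.min s (Num.min e (d / 3)).
  have r0 : 0 < r by rewrite !lt_min s0 e0 divr_gt0.
  have rs : r <= s by rewrite ge_min lexx.
  have re : r <= e by rewrite !ge_min lexx !orbT.
  have rd : r <= d / 3 by rewrite !ge_min lexx !orbT.
  rewrite (Bs r r0 rs); apply: le_trans (_ : 4 * K * (2 * r + 2 * r) <= _); last first.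
    rewrite (_ : 4 * K * (2 * r + 2 * r) = r * (16 * K)); last by ring.
    by rewrite ler_wpM2r// mulr_ge0.
  rewrite {1}(_ : 2 * r = x0 + r - (x0 - r)); last by ring.
  rewrite (_ : 2 * r = y0 + r - (y0 - r)); last by ring.
  apply: boundary_bound; [lra|lra|exact: cB|].
  apply: on_boundaryW (on_sq r r0) => z /andP[z1 z2]; apply: gK; first exact: (ne_z0 r).
  by apply: le_lt_trans z2 _; lra.
have Hk := boundary_kernel z0 s0.
rewrite -/x0 -/y0 in Hk; set k := boundary _ _ _ _ _ in Hk.
have ck : boundary_continuous (fun z : C => (z - z0)^-1) (x0 - s) (x0 + s) (y0 - s) (y0 + s).
  apply: on_boundaryW (on_sq s s0) => z /andP[z1 z2].
  apply/derivable_continuous/derivableV; first by rewrite subr_eq0; exact: (ne_z0 s).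
  by apply: derivableB; [exact: derivable_id|exact: derivable_cst].
have cfk : boundary_continuous (fun z : C => f z0 * (z - z0)^-1)
    (x0 - s) (x0 + s) (y0 - s) (y0 + s).
  by apply: on_boundaryW ck => z zc; apply: continuousM; [exact: cst_continuous|exact: zc].
have E : boundary (fun z => g z + f z0 * (z - z0)^-1) (x0 - s) (x0 + s) (y0 - s) (y0 + s)
    = f z0 * k.
  by rewrite (boundaryD (cB s s0 (lexx s)) cfk) -/(B s) B0 add0r (boundaryZ _ ck).
have cgk : boundary_continuous (fun z : C => g z + f z0 * (z - z0)^-1)
    (x0 - s) (x0 + s) (y0 - s) (y0 + s).
  have := on_boundaryI (cB s s0 (lexx s)) cfk.
  by apply: on_boundaryW => z [gz fz]; exact: (cvgD gz fz).
have := @boundary_bound _ (fun z => g z + f z0 * (z - z0)^-1) (M / s)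
  (x0 - s) (x0 + s) (y0 - s) (y0 + s).
rewrite E => H; have {H} : cn (f z0 * k) <= 4 * (M / s) * (2 * s + 2 * s).
  rewrite {1}(_ : 2 * s = x0 + s - (x0 - s)); last by ring.
  rewrite (_ : 2 * s = y0 + s - (y0 - s)); last by ring.
  apply: (H _ _ cgk); [lra|lra|].
  apply: on_boundaryW (on_sq s s0) => z zs; have /andP[z1 z2] := zs.
  rewrite /g -mulrDl subrK cnM cnV ler_pM ?cn_ge0 ?invr_ge0 ?cn_ge0//; first exact: fM.
  by rewrite lef_pV2// posrE//; exact: lt_le_trans z1.
have -> : 4 * (M / s) * (2 * s + 2 * s) = 16 * M by field; rewrite gt_eqF.
rewrite cnM => H; have : cn (f z0) * 4 <= 16 * M.
  by apply: le_trans H; rewrite ler_wpM2l ?cn_ge0.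
lra.
Qed.

End CauchyBound.

(** * Vanishing, open mapping and the identity theorem *)

Section LocalTheory.
Variable R : realType.
Local Notation C := (Cplx R).
Implicit Types (f g : C -> C).

Lemma le_expr_half (u K : R) : 0 <= K -> (forall n, u <= K / 2 ^+ n) -> u <= 0.
Proof.
move=> K0 H; apply: (le_eps K0) => e e0.
have := archi_boundP (x := e^-1); rewrite invr_ge0 (ltW e0) => /(_ isT).
move: (Num.bound _) => n en; apply: le_trans (H n) _; rewrite mulrC ler_wpM2r//.
rewrite -[leRHS]invrK lef_pV2 ?posrE ?invr_gt0 ?exprn_gt0//.
by apply: le_trans (ltW en) _; rewrite -natrX ler_nat ltnW// ltn_expl.
Qed.

Lemma derivable_exp f n (z : C) :
  derivable f z 1 -> derivable (fun w => f w ^+ n) z 1.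
Proof.
move=> df; elim: n => [|n ih].
  rewrite (_ : (fun _ => _) = cst 1); first exact: derivable_cst.
  by apply/funext => w; rewrite expr0.
rewrite (_ : (fun w => f w ^+ n.+1) = (fun w => f w * f w ^+ n)).
  by apply: derivableM; [exact: df|exact: ih].
by apply/funext => w; rewrite exprS.
Qed.

(** When [f] vanishes near [q], dividing it by [(z - q)^n] leaves it differentiable for every [n].
    The Cauchy estimate around [w] then gives [|f w| <= 4 M (|w - q| / (s / 2))^n <= 4 M / 2^n]. The
    radius [s] depends on [p] only, so [q] can be chosen afterwards. *)
Lemma vanish_nearby f (p : C) :
  (\forall z \near p, derivable f z 1) ->
  (forall d : R, 0 < d -> exists2 q, cn (q - p) < d & \forall z \near q, f z = 0) ->
  \forall z \near p, f z = 0.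
Proof.
move=> /nbhs_cnP[r1 r10 df] Hq.
have fp : {for p, continuous f} by apply/derivable_continuous/df; rewrite subrr cn0.
have /continuous_cnP/(_ 1 ltr01)[r2 r20 f1] := fp.
pose M := cn (f p) + 1.
have M0 : 0 <= M by rewrite addr_ge0 ?cn_ge0.
pose r := Num.min r1 r2.
have r0 : 0 < r by rewrite lt_min r10.
have fr z : cn (z - p) < r -> derivable f z 1 /\ cn (f z) <= M.
  rewrite lt_min => /andP[z1 z2]; split; first exact: df.
  have -> : f z = f p + (f z - f p) by ring.
  by apply: le_trans (cnD _ _) _; rewrite lerD2l ltW// f1.
(* With [w] within [s / 8] of [p], the disc of radius [2 s] about [w] stays well inside the disc of
   radius [r] about [p]. *)
have [s s0 rs] : exists2 s, 0 < s & r = 8 * s.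
  by exists (r / 8); [rewrite divr_gt0|field].
have [q qp /nbhs_cnP[eta eta0 fq]] := Hq (s / 8) (divr_gt0 s0 (ltr0n _ 8)).
apply/nbhs_cnP; exists (s / 8) => [|w wp]; first by rewrite divr_gt0.
have [wq|wq] := eqVneq w q.
  by rewrite wq; apply: fq; rewrite subrr cn0.
have wq4 : cn (w - q) < s / 4.
  by have := cn_dist p w q; rewrite (cnB p q); lra.
apply/eqP; rewrite -cn_eq0 eq_le cn_ge0 andbT.
apply: (@le_expr_half _ (4 * M)); first by rewrite mulr_ge0.
move=> n.
pose h z := f z * (z - q)^-1 ^+ n.
have wq0 : 0 < cn (w - q) by rewrite cn_gt0 subr_eq0.
have : cn (h w) <= 4 * (M * (s / 2)^-1 ^+ n).
  apply: (cauchy_bound s0) => [z zw|z /andP[z1 z2]].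
    have [->|zq] := eqVneq z q.
      (* Around [q] the factor [f] is 0, hence so is [h], including at [q] where the inverse takes
         its default value. *)
      apply: ex_derive; apply/derive_cnP; instantiate (1 := 0) => e e0; exists eta => // y yq.
      rewrite /h fq// fq ?subrr ?cn0// !mul0r !subrr cn0.
      by rewrite mulr_ge0 ?cn_ge0// ltW.
    apply: derivableM.
      apply: (fr _ _).1; apply: le_lt_trans (cn_dist w z p) _.
      by rewrite rs; lra.
    apply: derivable_exp; apply: derivableV; first by rewrite subr_eq0.
    by apply: derivableB; [exact: derivable_id|exact: derivable_cst].
  rewrite /h cnM cnX cnV; apply: ler_pM; rewrite ?cn_ge0 ?exprn_ge0 ?invr_ge0 ?cn_ge0//.
    apply: (fr _ _).2; apply: le_lt_trans (cn_dist w z p) _.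
    by rewrite rs; lra.
  rewrite lerXn2r ?nnegrE ?invr_ge0 ?cn_ge0//; first lra.
  have zq : s / 2 <= cn (z - q) by have := cn_dist q z w; rewrite (cnB q w); lra.
  by rewrite lef_pV2 ?posrE; lra.
rewrite /h cnM cnX cnV -ler_pdivlMr ?exprn_gt0 ?invr_gt0// => /le_trans; apply.
rewrite -!mulrA ler_wpM2l// ler_wpM2l// -!exprVn invrK -exprMn.
rewrite lerXn2r ?nnegrE ?mulr_ge0 ?invr_ge0 ?(ltW wq0)//; first lra.
rewrite mulrC ler_pdivrMr; lra.
Qed.

(** If [g] omitted a value [w] close to [g z0], then [1 / (g - w)] would be differentiable on the
    disc of radius [2 s]. Its modulus would exceed [8 / A] at the centre but be at most [8 / (7 A)]
    on the ring, against the Cauchy estimate. *)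
Lemma open_image g (z0 l : C) : (\forall z \near z0, derivable g z 1) ->
  is_derive z0 (1 : C) g l -> l != 0 ->
  forall r : R, 0 < r -> \forall w \near g z0, exists2 z, cn (z - z0) < r & g z = w.
Proof.
move=> /nbhs_cnP[r1 r10 dg] /derive_cnP gl l0 r r0.
have l1 : 0 < cn l by rewrite cn_gt0.
(* An error of half the slope leaves [|g z - g z0| >= |l| / 2 * |z - z0|], which is at least [A] on
   the ring. *)
have [r2 r20 Hl] := gl (cn l / 2) (divr_gt0 l1 (ltr0n _ 2)).
pose s := Num.min r (Num.min r1 r2) / 3.
have s0 : 0 < s by rewrite divr_gt0// !lt_min r0 r10.
have sr z : cn (z - z0) <= 2 * s -> [/\ cn (z - z0) < r, cn (z - z0) < r1 & cn (z - z0) < r2].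
  move=> zs; have : cn (z - z0) < Num.min r (Num.min r1 r2) by rewrite /s in zs s0; lra.
  by rewrite !lt_min => /and3P[].
have [A A0 AE] : exists2 A, 0 < A & A = cn l / 2 * s.
  by exists (cn l / 2 * s); rewrite // mulr_gt0// divr_gt0.
apply/nbhs_cnP; exists (A / 8) => [|w wA]; first by rewrite divr_gt0.
apply: contrapT => nw.
have gw z : cn (z - z0) <= 2 * s -> g z - w != 0.
  by move=> /sr[zr _ _]; rewrite subr_eq0; apply/eqP => gz; apply: nw; exists z.
have gz0w : g z0 - w != 0 by apply: gw; rewrite subrr cn0 mulr_ge0// ltW.
have : cn ((g z0 - w)^-1) <= 4 * (7 / 8 * A)^-1.
  apply: (cauchy_bound (f := fun z => (g z - w)^-1) s0) => [z zs|z /andP[z1 z2]].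
    apply: derivableV; first exact: gw.
    by apply: derivableB; [apply: dg; have [] := sr _ zs|exact: derivable_cst].
  rewrite cnV lef_pV2 ?posrE ?cn_gt0 ?gw//; last by lra.
  have [_ _ /Hl zl] := sr _ z2.
  have h1 : cn (l * (z - z0)) <= cn (g z - g z0) + cn (g z - g z0 - l * (z - z0)).
    have := cnD (g z - g z0) (- (g z - g z0 - l * (z - z0))).
    by rewrite cnN opprB addrC subrK.
  have h2 : A <= cn l / 2 * cn (z - z0) by rewrite AE ler_wpM2l// divr_ge0// ltW.
  have h3 := cn_dist w (g z) (g z0).
  by move: h1; rewrite cnM; lra.
rewrite cnV; have gA : cn (g z0 - w) < A / 8 by rewrite cnB.
have -> : 4 * (7 / 8 * A)^-1 = (7 / 32 * A)^-1 by field; rewrite gt_eqF.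
by rewrite lef_pV2 ?posrE ?cn_gt0//; lra.
Qed.

End LocalTheory.

Section SurfaceIdentity.
Variable R : realType.
Local Notation C := (Cplx R).

(** The set of points near which [F] vanishes is open and nonempty; it is closed by [vanish_nearby]
    read in a chart at a limit point. Connectedness concludes. *)
Lemma rs_identity (T : riemann_surface R) (F : T -> C) (x0 : T) :
  rs_holomorphic_fun F -> (\forall x \near x0, F x = 0) -> forall x, F x = 0.
Proof.
move=> hF F0; pose A : set T := [set x | \forall y \near x, F y = 0].
have oA : open A by rewrite openE => x; rewrite /A /= => /nbhs_interior.
have cA : closed A.
  move=> x clx; have [c ca cx] := rs_cover x.
  have [odom oimg invc cc cinv] := rs_charts ca.
  have img_p : chart_img c (c x) by exists x.
  have Fp : \forall z \near c x, (F \o chart_inv c) z = 0.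
    apply: vanish_nearby.
      by apply: filterS (open_nbhs_nbhs (conj oimg img_p)) => z; exact: hF.
    move=> d d0.
    have nx : nbhs x (chart_dom c `&` [set y | cn (c y - c x) < d]).
      apply: filterI; first exact: open_nbhs_nbhs.
      apply: (cc x cx [set w | cn (w - c x) < d]).
      by apply/nbhs_cnP; exists d.
    have [y [Ay [cy yd]]] := clx _ nx; exists (c y) => //.
    have img_y : chart_img c (c y) by exists y.
    apply: (cinv _ img_y [set y | F y = 0]).
    by rewrite invc//; exact: Ay.
  have : \forall y \near x, chart_dom c y /\ (F \o chart_inv c) (c y) = 0.
    apply: filterI; first exact: open_nbhs_nbhs.
    exact: (cc x cx [set w | (F \o chart_inv c) w = 0]).
  by apply: filterS => y [cy]; rewrite /= invc.
have AT : A = [set: T].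
  apply: rs_connected; first by exists x0.
    by exists A => //; rewrite setTI.
  by exists A => //; rewrite setTI.
move=> x; have : A x by rewrite AT.
exact: nbhs_singleton.
Qed.

End SurfaceIdentity.

(** * Plane domains as Riemann surfaces *)

Section PlaneDomain.
Variable R : realType.
Local Notation C := (Cplx R).
Variables (U : set C) (regU : region U).

Let S : topologicalType := set_type U.

Let U0 : {u : C | U u}.
Proof. by apply: cid; case: regU. Qed.

Definition domain_pt : set_type U :=
  exist _ (sval U0) (mem_set (svalP U0)).

Definition domain_val (x : set_type U) : C := \val x.

(** Total, as [chart_inv] and [ac_emb] must be: outside [U] the value is the base point
    [domain_pt]. *)
Definition domain_inj (z : C) : set_type U := insubd domain_pt z.

Lemma domain_valP x : U (domain_val x).
Proof. by apply: set_mem; exact: valP. Qed.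

Lemma domain_injK z : U z -> domain_val (domain_inj z) = z.
Proof. by move=> Uz; rewrite /domain_val /domain_inj insubdK//; exact: mem_set. Qed.

Lemma domain_valK x : domain_inj (domain_val x) = x.
Proof. by rewrite /domain_inj /domain_val valKd. Qed.

Lemma domain_val_continuous : continuous (domain_val : S -> C).
Proof. exact: initial_continuous. Qed.

(** The topology of the subtype is the initial one for the inclusion. *)
Lemma domain_continuous (X : topologicalType) (f : X -> S) x :
  {for x, continuous (domain_val \o f)} -> {for x, continuous f}.
Proof.
move=> cf A [/= _ [[W oW <-]] /= Wfx /filterS]; apply; apply: cf.
exact: open_nbhs_nbhs.
Qed.

Let oU : open U. Proof. by case: regU. Qed.

Lemma near_domain z : U z -> \forall w \near z, U w.
Proof. by move=> Uz; exact: open_nbhs_nbhs. Qed.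

Lemma near_domain_injK z : U z -> \forall w \near z, domain_val (domain_inj w) = w.
Proof. by move=> Uz; apply: filterS (near_domain Uz) => w; exact: domain_injK. Qed.

Lemma domain_inj_continuous z : U z -> {for z, continuous (domain_inj : C -> S)}.
Proof.
move=> Uz; apply: domain_continuous => A /=; rewrite domain_injK// => zA.
suff : nbhs z [set w | A (domain_val (domain_inj w))] by [].
by apply: filterS (filterI (near_domain_injK Uz) zA) => w /= [->].
Qed.

Definition domain_chart : chart R S := Chart setT (domain_val : S -> C) domain_inj.

Lemma domain_chart_img : chart_img domain_chart = U.
Proof.
apply/seteqP; split=> [_ [x _ <-]|z Uz]; first exact: domain_valP.
by exists (domain_inj z) => //; exact: domain_injK.
Qed.

Lemma domain_chartP : is_chart domain_chart.
Proof.
split.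
- exact: openT.
- by rewrite domain_chart_img.
- by move=> x _; exact: domain_valK.
- by move=> x _; exact: domain_val_continuous.
- by rewrite domain_chart_img => z; exact: domain_inj_continuous.
Qed.

Lemma domain_hausdorff : hausdorff_space S.
Proof.
move=> x y xy; apply: val_inj; apply: (@norm_hausdorff _ C) => A B nA nB.
have [t [tA tB]] := xy _ _ (domain_val_continuous nA) (domain_val_continuous nB).
by exists (domain_val t).
Qed.

Lemma domain_connected : connected [set: S].
Proof.
rewrite (_ : [set: S] = (domain_inj : C -> S) @` U); last first.
  apply/seteqP; split=> // x _; exists (domain_val x); first exact: domain_valP.
  exact: domain_valK.
apply: connected_continuous_connected; first by case: regU.
by apply: continuous_in_subspaceT => z /set_mem; exact: domain_inj_continuous.
Qed.

Lemma near_derivable_eq (V : normedModType C) (f g : C -> V) (z : C) :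
  (\forall w \near z, f w = g w) -> derivable f z 1 -> derivable g z 1.
Proof. exact: near_eq_derivable. Qed.

(** The inclusion is the only chart, and the only transition map is locally the identity. The
    definition is transparent so that points of the surface are, by computation, points of
    [set_type U]. *)
Definition domain_surface : riemann_surface R.
Proof.
refine (@RiemannSurface R S [set domain_chart] _ domain_hausdorff domain_connected _ _ _).
- by exists domain_pt.
- by move=> _ ->; exact: domain_chartP.
- by move=> x; exists domain_chart.
- move=> _ _ -> -> _ [x _ <-]; apply: (near_derivable_eq (f := id)); last exact: derivable_id.
  by apply: filterS (near_domain_injK (domain_valP x)) => w /esym.
Defined.

Variable (f : C -> 'rV[C]_2).
Hypothesis (holof : holomorphic_on U f) (fM : forall z, U z -> @Mspace R (f z)).

Definition domain_continuation : continuation U f.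
Proof.
refine (@Continuation R U f domain_surface domain_val domain_inj (f \o domain_val)
   _ _ _ _ _ _ _ _).
- move=> _ ->; rewrite domain_chart_img => z Uz.
  apply: (near_derivable_eq (f := id)); last exact: derivable_id.
  by apply: filterS (near_domain_injK Uz) => w /esym.
- have /nbhs_cnP[d d0 H] := near_domain (domain_valP domain_pt).
  (* A disc of radius [d] about the base point lies in [U]; shifting by [d / 2] gives a second
     point. *)
  exists (domain_inj (domain_val domain_pt + rtoc (d / 2))), domain_pt.
  rewrite domain_injK; last first.
    by apply: H; rewrite addrC addKr cn_rtoc ger0_norm; lra.
  rewrite -subr_eq0 addrC addKr -cn_eq0 cn_rtoc normr_eq0 gt_eqF//; lra.
- by move=> z Uz; exists (domain_inj z) => //; exact: domain_injK.
- move=> z Uz; split; first exact: domain_inj_continuous.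
  move=> _ -> _; have H : \forall w \near z, w = (domain_chart \o domain_inj) w.
    by apply: filterS (near_domain_injK Uz) => w /esym.
  split; first by apply: (near_derivable_eq H); exact: derivable_id.
  by rewrite -(near_eq_derive _ H) derive_id oner_eq0.
- exact: domain_injK.
- move=> _ ->; rewrite domain_chart_img => z Uz.
  apply: (near_derivable_eq (f := f)); last exact: holof.
  by apply: filterS (near_domain_injK Uz) => w /= ->.
- by move=> x; apply: fM; exact: domain_valP.
- by move=> z Uz /=; rewrite domain_injK.
Defined.

End PlaneDomain.

(** * Maximality of plane domains *)

Section Maximality.
Variable R : realType.
Local Notation C := (Cplx R).

Lemma derivable_comp1 (f g : C -> C) (z : C) :
  derivable f z 1 -> derivable g (f z) 1 -> derivable (g \o f) z 1.
Proof.
move=> /derivable1_diffP df /derivable1_diffP dg.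
by apply/derivable1_diffP; exact: (differentiable_comp df dg).
Qed.

Lemma derivable_coord1 n (f : C -> 'rV[C]_n) (z : C) i :
  derivable f z 1 -> derivable (fun w => f w 0 i) z 1.
Proof.
move=> /derivable1_diffP df; apply/derivable1_diffP.
apply: (differentiable_comp (g := fun M : 'rV[C]_n => M 0 i) df).
exact: differentiable_coord.
Qed.

Lemma rs_holomorphic_continuous (T : riemann_surface R) (F : T -> C) :
  rs_holomorphic_fun F -> continuous F.
Proof.
move=> hF x; have [c ca cx] := rs_cover x.
have [odom oimg invc cc cinv] := rs_charts ca.
have img_x : chart_img c (c x) by exists x.
move=> A nA; have nA' : nbhs ((F \o chart_inv c) (c x)) A by rewrite /= invc.
have nB : nbhs x [set y | A ((F \o chart_inv c) (c y))].
  exact: (continuous_comp (cc x cx) (derivable_continuous (hF c ca _ img_x)) nA').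
apply: filterS (filterI (open_nbhs_nbhs (conj odom cx)) nB) => y [cy].
by rewrite /= invc.
Qed.

(** Read in a chart, the immersion has nonzero derivative, so by [open_image] its image contains a
    neighbourhood of the embedded point. *)
Lemma near_embedding (U : set C) (f : C -> 'rV[C]_2) (T : continuation U f)
    (P : T -> Prop) (z : C) : region U -> U z ->
  (forall w, U w -> P (ac_emb T w)) -> \forall x \near ac_emb T z, P x.
Proof.
move=> [_ oU _] Uz HP; set x := ac_emb T z.
have [c ca cx] := rs_cover x.
have [odom oimg invc cc cinv] := rs_charts ca.
have imm := @ac_emb_immersion _ _ _ T.
have nU : \forall w \near z, U w /\ chart_dom c (ac_emb T w).
  apply: filterI; first exact: open_nbhs_nbhs.
  apply: (imm z Uz).1 (chart_dom c) _; exact: open_nbhs_nbhs.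
have [/derivableP gd g0] := (imm z Uz).2 c ca cx.
have dg : \forall w \near z, derivable (c \o ac_emb T) w 1.
  apply: filterS nU => w [Uw dw].
  exact: ((imm w Uw).2 c ca dw).1.
have /nbhs_cnP[r r0 Hr] := nU.
have H := open_image dg gd g0 r0.
have : \forall y \near x, chart_dom c y /\ exists2 w, cn (w - z) < r & c (ac_emb T w) = c y.
  apply: filterI; first exact: open_nbhs_nbhs.
  exact: (cc x cx _ H).
apply: filterS => y [cy [w /Hr[Uw dw] E]].
(* A chart is injective on its domain, so [y] is the embedded point [ac_emb T w]. *)
by rewrite -(invc y cy) -E invc//; exact: HP.
Qed.

Lemma domain_maximal (U : set C) (f : C -> 'rV[C]_2) (regU : region U)
    (holof : holomorphic_on U f) (fM : forall z, U z -> @Mspace R (f z))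
    (N D : C -> C) (i : 'I_2) :
  (forall z, derivable N z 1) -> (forall z, derivable D z 1) ->
  (forall z, D z = 0 -> N z != 0) -> (forall z, D z != 0 -> U z) ->
  (forall z, U z -> D z * f z 0 i = N z) ->
  is_riemann_surface_of (domain_continuation regU holof fM).
Proof.
move=> dN dD ND DU fE T.
pose F (x : T) : C := D (ac_proj x) * ac_map x 0 i - N (ac_proj x).
have hF : rs_holomorphic_fun F.
  move=> c ca z cz; apply: derivableB.
    apply: derivableM.
      exact: (derivable_comp1 (ac_proj_holo ca cz) (dD _)).
    exact: (derivable_coord1 (@ac_map_holo _ _ _ T c ca z cz)).
  exact: (derivable_comp1 (ac_proj_holo ca cz) (dN _)).
have [[u0 Uu0] oU _] := regU.
have F0 x : F x = 0.
  move: x; apply: (rs_identity (x0 := ac_emb T u0) hF).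
  apply: (near_embedding (P := fun x => F x = 0) regU Uu0) => z Uz.
  by rewrite /F ac_emb_section// ac_map_ext// fE// subrr.
(* At a zero of [D] the identity [F x = 0] would force [N] to vanish too. *)
have UT x : U (ac_proj (c := T) x).
  apply: DU; apply/eqP => Dx; have /eqP := F0 x; apply/negP.
  by rewrite /F Dx mul0r sub0r oppr_eq0; exact: ND.
exists (fun x => domain_inj regU (ac_proj (c := T) x)); split; last first.
  by move=> z Uz /=; rewrite ac_emb_section.
split.
  move=> x; apply: domain_continuous.
  rewrite (_ : _ \o _ = ac_proj (c := T)); last first.
    by apply/funext => y /=; rewrite domain_injK.
  exact: (rs_holomorphic_continuous (@ac_proj_holo _ _ _ T)).
move=> c c' ca -> _ [x [cx _] <-].
(* In the single chart of the plane domain the morphism reads as the projection. *)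
rewrite (_ : _ \o _ = ac_proj (c := T) \o chart_inv c); last first.
  by apply/funext => y /=; rewrite domain_injK.
by apply: (@ac_proj_holo _ _ _ T) => //; exists x.
Qed.

End Maximality.

(** * The complex exponential *)

Section ComplexExponential.
Variable R : realType.
Local Notation C := (Cplx R).
Implicit Types (z w : C) (x y t : R).

(** Real counterpart of one direction of [derive_cnP]. *)
Lemma is_derive_bound (f : R -> R) (x l : R) : is_derive x 1 f l ->
  forall e, 0 < e -> exists2 d, 0 < d &
    forall y, `|y - x| < d -> `|f y - f x - l * (y - x)| <= e * `|y - x|.
Proof.
move=> [df fl] e e0.
pose q := fun h : R => h^-1 *: (f (h *: (1 : R) + x) - f x).
have ql : q @ (0 : R)^' --> l by rewrite -fl; exact: df.
have : \forall h \near (0 : R), h != 0 -> `|l - q h| < e.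
  by move/cvgrPdist_lt : ql => /(_ e e0).
move=> /nbhs_ballP[d /= d0 Hd]; exists d => // y yd.
have [->|yx] := eqVneq y x; first by rewrite !subrr mulr0 subrr normr0 mulr0.
have h0 : y - x != 0 by rewrite subr_eq0.
have hE : f y - f x = (y - x) * q (y - x).
  rewrite /q /GRing.scale /= mulr1 subrK mulrA divff// mul1r //.
rewrite hE (mulrC l) -mulrBr normrM mulrC ler_wpM2r// distrC ltW//.
by apply: Hd => //=; rewrite -ball_normE /= sub0r normrN.
Qed.

Definition cexp z : C :=
  rtoc (expR (complex.Re z)) * Cpt (cos (complex.Im z)) (sin (complex.Im z)).

Lemma cexpD z w : cexp (z + w) = cexp z * cexp w.
Proof.
case: z w => a b [c d]; rewrite /cexp /= expRD cosD sinD.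
by apply/eqP; rewrite eq_complex /=; apply/andP; split; apply/eqP; ring.
Qed.

Lemma cexp0 : cexp 0 = 1.
Proof.
rewrite /cexp /= expR0 cos0 sin0.
by apply/eqP; rewrite eq_complex /= !mul0r !mulr0 mul1r subr0 addr0 !eqxx.
Qed.

Lemma cn_cexp z : cn (cexp z) = expR (complex.Re z).
Proof.
rewrite /cexp cnM cn_rtoc ger0_norm ?expR_ge0//.
by rewrite /cn /= cos2Dsin2 sqrtr1 mulr1.
Qed.

Lemma cexp_neq0 z : cexp z != 0.
Proof. by rewrite -cn_gt0 cn_cexp expR_gt0. Qed.

Lemma cexp_i t : cexp (Cpt 0 t) = Cpt (cos t) (sin t).
Proof. by rewrite /cexp /= expR0 mul1r. Qed.

(** The first-order expansions of the real [expR], [cos] and [sin] at 0 are combined; the remainder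
    splits into four terms bounded by multiples of [e1 * r], with [r = |z|]. *)
Lemma is_derive_cexp0 : is_derive (0 : C) (1 : C) cexp 1.
Proof.
apply/derive_cnP => e e0.
(* The four terms add up to at most [6 * e1 * r], hence the 8. The further restriction
   [|z| < e1 / 2] below makes [|expR x - 1| <= e1]. *)
pose e1 := Num.min 1 (e / 8).
have e10 : 0 < e1 by rewrite lt_min ltr01 divr_gt0.
have e11 : e1 <= 1 by rewrite ge_min lexx.
have e1e : e1 <= e / 8 by rewrite ge_min lexx orbT.
have [d1 d10 H1] := is_derive_bound (is_derive_expR (0 : R)) e10.
have [d2 d20 H2] := is_derive_bound (is_derive_cos (0 : R)) e10.
have [d3 d30 H3] := is_derive_bound (is_derive_sin (0 : R)) e10.
pose d := Num.min (Num.min d1 d2) (Num.min d3 (e1 / 2)).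
exists d; first by rewrite !lt_min d10 d20 d30 divr_gt0.
move=> z; rewrite !subr0 cexp0 mul1r => zd.
have [z1 z2 z3 z4] : [/\ cn z < d1, cn z < d2, cn z < d3 & cn z < e1 / 2].
  by move: zd; rewrite !lt_min => /andP[/andP[? ?] /andP[? ?]].
have xz := Re_le_cn z; have yz := Im_le_cn z.
case: z zd z1 z2 z3 z4 xz yz => x y zd z1 z2 z3 z4 xz yz.
have {}xz : `|x| <= cn (Complex x y) := xz.
have {}yz : `|y| <= cn (Complex x y) := yz.
have {H1} := H1 x; rewrite !subr0 expR0 mul1r => /(_ (le_lt_trans xz z1)) H1.
have {H2} := H2 y; rewrite !subr0 cos0 sin0 oppr0 mul0r subr0.
move=> /(_ (le_lt_trans yz z2)) H2.
have {H3} := H3 y; rewrite !subr0 cos0 sin0 subr0 mul1r.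
move=> /(_ (le_lt_trans yz z3)) H3.
set r := cn (Complex x y) in zd z1 z2 z3 z4 xz yz *.
have E : cexp (Complex x y) - 1 - Complex x y =
    Complex ((expR x - 1 - x) * cos y + (1 + x) * (cos y - 1))
            ((expR x - 1) * sin y + (sin y - y)).
  by apply/eqP; rewrite eq_complex /=; apply/andP; split; apply/eqP; ring.
rewrite E; apply: le_trans (cn_le _) _ => /=.
have x2 : `|x| <= 1 / 2 by lra.
have r0 : 0 <= r by apply: le_trans xz.
have cy : `|cos y| <= 1 by rewrite ler_norml cos_geN1 cos_le1.
have b1 : `|(expR x - 1 - x) * cos y| <= e1 * r.
  rewrite normrM -[leRHS]mulr1 ler_pM//.
  by apply: le_trans H1 _; rewrite ler_pM2l.
have b2 : `|(1 + x) * (cos y - 1)| <= 2 * (e1 * r).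
  rewrite normrM ler_pM//.
    by apply: le_trans (ler_normD _ _) _; rewrite normr1; lra.
  by apply: le_trans H2 _; rewrite ler_pM2l.
have b3 : `|expR x - 1| <= e1.
  have -> : expR x - 1 = (expR x - 1 - x) + x by ring.
  apply: le_trans (ler_normD _ _) _.
  have : e1 * `|x| <= 1 * `|x| by rewrite ler_wpM2r.
  by move: H1; lra.
have b4 : `|sin y| <= 2 * r.
  have -> : sin y = (sin y - y) + y by ring.
  apply: le_trans (ler_normD _ _) _.
  have : e1 * `|y| <= 1 * `|y| by rewrite ler_wpM2r.
  by move: H3; lra.
have b5 : `|(expR x - 1) * sin y| <= e1 * (2 * r) by rewrite normrM ler_pM.
have b6 : `|sin y - y| <= e1 * r by apply: le_trans H3 _; rewrite ler_pM2l.
apply: le_trans (lerD (ler_normD _ _) (ler_normD _ _)) _.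
have : e1 * r <= e / 8 * r by rewrite ler_wpM2r.
have : 0 <= e * r by rewrite mulr_ge0// ltW.
lra.
Qed.

(** The addition formula reduces the claim to the point 0. *)
Lemma is_derive_cexp z : is_derive z (1 : C) cexp (cexp z).
Proof.
apply/derive_cnP => e e0; have z0 : 0 < cn (cexp z) by rewrite cn_gt0 cexp_neq0.
have /derive_cnP/(_ (e / cn (cexp z)))[|d d0 Hd] := is_derive_cexp0.
  by rewrite divr_gt0.
exists d => // w wz.
have -> : cexp w - cexp z - cexp z * (w - z) =
    cexp z * (cexp (w - z) - cexp 0 - 1 * (w - z - 0)).
  have E : cexp w = cexp z * cexp (w - z) by rewrite -cexpD addrC subrK.
  by rewrite {1}E subr0 cexp0; ring.
rewrite cnM; have := Hd (w - z); rewrite subr0 => /(_ wz) H.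
apply: le_trans (ler_wpM2l (ltW z0) H) _.
by rewrite le_eqVlt; apply/orP; left; apply/eqP; field; rewrite gt_eqF.
Qed.

End ComplexExponential.

(** * A criterion for completeness *)

Section Criterion.
Variable R : realType.
Local Notation C := (Cplx R).
Implicit Types (z w : C) (t : R).

(** The index [i] of the varying coordinate is a parameter, so that one argument serves for both [u]
    and [v]. *)
Definition vec_at (K : Type) (i : 'I_2) (a b : K) : 'rV[K]_2 :=
  \row_(j < 2) (if j == i then a else b).

Lemma ord2_cases (i : 'I_2) : i = 0 \/ i = 1.
Proof. by case: i => [[|[|n]] ni]//; [left|right]; exact: val_inj. Qed.

Lemma vec_at_sqr (i : 'I_2) (a b : C) :
  vec_at i a b 0 0 ^+ 2 + vec_at i a b 0 1 ^+ 2 = a ^+ 2 + b ^+ 2.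
Proof. by rewrite !mxE; have [->|->] := ord2_cases i; rewrite //= addrC. Qed.

(** The two removed lines are the zeros of [u^2 + v^2 = (u + i v) (u - i v)]. *)
Lemma Mspace_sqr (p : 'rV[C]_2) : p 0 0 ^+ 2 + p 0 1 ^+ 2 != 0 -> @Mspace R p.
Proof.
move=> /eqP H [] [l _ E]; apply: H; rewrite -E !mxE /= exprMn.
  by rewrite exprMn sqrCi; ring.
by rewrite exprMn sqrrN sqrCi; ring.
Qed.

Lemma holomorphic_vec_at (i : 'I_2) (g : C -> C) (c : C) z :
  derivable g z 1 -> derivable (fun w => vec_at i (g w) c) z 1.
Proof.
move=> dg.
rewrite (_ : (fun w => vec_at i (g w) c) =
  (fun w => g w *: vec_at i 1 0 + vec_at i 0 c)); last first.
  apply/funext => w; apply/rowP => j; rewrite !mxE.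
  by case: ifP => _; rewrite ?mulr1 ?addr0 ?mulr0 ?add0r.
apply: derivableD; last exact: derivable_cst.
apply/derivable1_diffP/differentiableZl; exact/derivable1_diffP.
Qed.

Lemma connected_segment z w :
  connected [set z + rtoc s * (w - z) | s in `[0, 1]].
Proof.
apply: connected_continuous_connected; first exact: segment_connected.
apply: continuous_subspaceT => s; apply/(cvg_cnP (nbhs_filter s)) => e e0.
have K0 : 0 < cn (w - z) + 1 by rewrite ltr_wpDl ?cn_ge0.
have := @nbhsx_ballx _ R s _ (divr_gt0 e0 K0).
apply: filterS => t st.
have -> : z + rtoc t * (w - z) - (z + rtoc s * (w - z)) = rtoc (t - s) * (w - z).
  by rewrite rtocD rtocN; ring.
rewrite cnM cn_rtoc distrC.
have {}st : `|s - t| < e / (cn (w - z) + 1) := st.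
apply: le_lt_trans (_ : `|s - t| * (cn (w - z) + 1) < e).
  by rewrite ler_wpM2l// lerDl.
by rewrite -ltr_pdivlMr.
Qed.

(** A segment from a nonreal point to [t0] meets the real axis at [t0] only. A real point outside
    [Z] is first joined to [z + i] by a vertical segment. *)
Lemma connected_slit (Z : set C) (t0 : R) :
  (forall z, Z z -> complex.Im z = 0) -> ~ Z (rtoc t0) -> connected (~` Z).
Proof.
move=> ZR Zt0.
have up z : complex.Im z != 0 -> exists A : set C,
    [/\ connected A, A z, A (rtoc t0) & A `<=` ~` Z].
  move=> z0; exists [set z + rtoc s * (rtoc t0 - z) | s in `[0, 1]]; split.
  - exact: connected_segment.
  - by exists 0; rewrite /= ?in_itv/= ?lexx ?ler01// rtoc0 mul0r addr0.
  - by exists 1; rewrite /= ?in_itv/= ?lexx ?ler01// rtoc1 mul1r addrC subrK.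
  - move=> _ [s _ <-] Zs; have := ZR _ Zs => H.
    have s1 : s = 1.
      apply/eqP; move: H z0; case: (z) => x y /= H y0.
      have : (1 - s) * y = 0 by rewrite -H; ring.
      by move/eqP; rewrite mulf_eq0 (negbTE y0) orbF subr_eq0 eq_sym.
    by apply: Zt0; move: Zs; rewrite s1 rtoc1 mul1r addrC subrK.
suff -> : ~` Z = connected_component (~` Z) (rtoc t0) by exact: component_connected.
apply/seteqP; split; last exact: connected_component_sub.
move=> z Zz; suff [A [cA Az At AZ]] : exists A : set C,
    [/\ connected A, A z, A (rtoc t0) & A `<=` ~` Z] by exists A.
have [z0|] := eqVneq (complex.Im z) 0; last exact: up.
have [|A [cA Aw At AZ]] := up (z + Cpt 0 1).
  by case: z z0 {Zz} => x y /= ->; rewrite add0r oner_eq0.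
exists ([set z + rtoc s * (z + Cpt 0 1 - z) | s in `[0, 1]] `|` A); split.
- apply: connectedU => //; last exact: connected_segment.
  exists (z + Cpt 0 1); split => //; exists 1; first by rewrite /= in_itv/= lexx ler01.
  by rewrite rtoc1 mul1r addrC subrK.
- by left; exists 0; rewrite /= ?in_itv/= ?lexx ?ler01// rtoc0 mul0r addr0.
- by right.
- move=> w [[s _ <-] Zs|/AZ//]; have H := ZR _ Zs.
  have s0 : s = 0.
    move: H; have -> : z + rtoc s * (z + Cpt 0 1 - z) = z + rtoc s * Cpt 0 1 by ring.
    by case: (z) z0 => x y /= -> <-; ring.
  by apply: Zz; move: Zs; rewrite s0 rtoc0 mul0r addr0.
Qed.

(** A nearby zero [w] would satisfy [|l| |w - z| <= |l| / 2 * |w - z|]. *)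
Lemma isolated_zero (D : C -> C) z l : is_derive z (1 : C) D l -> l != 0 ->
  D z = 0 -> \forall w \near z, D w = 0 -> w = z.
Proof.
move=> /derive_cnP H l0 Dz; have l1 : 0 < cn l by rewrite cn_gt0.
have [d d0 Hd] := H (cn l / 2) (divr_gt0 l1 (ltr0n _ 2)).
apply/nbhs_cnP; exists d => // w /Hd; rewrite Dz subr0 => + Dw.
rewrite Dw sub0r cnN cnM => {}H; apply/eqP; rewrite -subr_eq0 -cn_eq0 eq_le cn_ge0 andbT.
by rewrite leNgt; apply/negP => wz; move: H; rewrite ler_pM2r//; lra.
Qed.

Lemma near_rtoc (P : C -> Prop) t :
  (\forall z \near rtoc t, P z) -> \forall s \near t, P (rtoc s).
Proof.
move=> /nbhs_cnP[d d0 Hd]; have := @nbhsx_ballx _ R t _ d0.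
apply: filterS => s st; apply: Hd; rewrite -rtocN -rtocD cn_rtoc distrC; exact: st.
Qed.

(** The germ extends as [(N / D, c)] to [{D <> 0}], which is connected because the zeros are real,
    and [domain_maximal] makes this domain its Riemann surface. Over a real point of it the value is
    real, hence in [d(N)]; so exceptional points are zeros of [D], isolated because simple. *)
Lemma complete_criterion (I : set R) (gamma : R -> 'rV[R]_2) (N D : C -> C)
    (i : 'I_2) (c : R) :
  I !=set0 ->
  (forall z, derivable N z 1) -> (forall z, derivable D z 1) ->
  (forall z, D z = 0 -> N z != 0) ->
  (forall z, D z = 0 -> 'D_1 D z != 0) ->
  (forall z, D z = 0 -> complex.Im z = 0) ->
  (forall z, D z != 0 -> N z ^+ 2 + (rtoc c * D z) ^+ 2 != 0) ->
  (forall t, D (rtoc t) != 0 -> exists u : R, N (rtoc t) = rtoc u * D (rtoc t)) ->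
  (forall t, I t -> D (rtoc t) != 0) ->
  (forall t, I t -> N (rtoc t) = rtoc (gamma t 0 i) * D (rtoc t)) ->
  (forall t j, I t -> j != i -> gamma t 0 j = c) ->
  complete_curve I gamma.
Proof.
move=> [t0 It0] dN dD ND simple DR DM Dreal ID IN Ic.
pose U : set C := [set z | D z != 0].
pose f z : 'rV[C]_2 := vec_at i (N z / D z) (rtoc c).
have UE : U = ~` [set z | D z = 0] by apply/seteqP; split=> z /eqP.
have oU : open U.
  rewrite openE => z /= Dz.
  have /continuous_cnP/(_ (cn (D z)))[|d d0 Hd] := derivable_continuous (dD z).
    by rewrite cn_gt0.
  apply/nbhs_cnP; exists d => // w /Hd; rewrite /U /=; apply: contraTneq => ->.
  by rewrite sub0r cnN ltxx.
have regU : region U.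
  split=> //; first by exists (rtoc t0); exact: ID.
  by rewrite UE; apply: (@connected_slit _ t0) => //=; apply/eqP; exact: ID.
have holof : holomorphic_on U f.
  move=> z Uz; apply: holomorphic_vec_at; apply: derivableM; first exact: dN.
  by apply: derivableV => //; exact: dD.
have fM z : U z -> @Mspace R (f z).
  move=> Uz; apply: Mspace_sqr; rewrite vec_at_sqr.
  have -> : (N z / D z) ^+ 2 + rtoc c ^+ 2 = (N z ^+ 2 + (rtoc c * D z) ^+ 2) / D z ^+ 2.
    by field.
  by rewrite mulf_neq0 ?DM// invr_eq0 expf_neq0.
have fE t u : D (rtoc t) != 0 -> N (rtoc t) = rtoc u * D (rtoc t) ->
    f (rtoc t) = complexify (vec_at i u c).
  move=> Dt Nt; apply/rowP => j; rewrite !mxE Nt mulfK//.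
  by case: ifP.
exists U, f; split.
  split=> // t It.
  rewrite (fE _ _ (ID _ It) (IN _ It)); congr complexify; apply/rowP => j.
  by rewrite !mxE; case: eqVneq => [->//|ji]; rewrite (Ic _ _ It ji).
exists (domain_continuation regU holof fM).
  apply: (@domain_maximal _ U f regU holof fM N D i dN dD ND) => [z|z Uz]; first exact.
  by rewrite /f mxE eqxx mulrC divfK.
set E := [set t | _].
have ED t : E t -> D (rtoc t) = 0.
  move=> Et; apply: contrapT => /eqP Dt; apply: Et.
  have [u Nu] := Dreal t Dt.
  exists (domain_inj regU (rtoc t)); last by rewrite /= domain_injK.
  rewrite /= domain_injK//; exists (vec_at i u c); last by rewrite (fE t u).
  rewrite /Nspace /=; apply/eqP => uc0.
  (* If [(u, c)] were 0, then [N^2 + (c D)^2 = (u^2 + c^2) D^2] would vanish. *)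
  have := DM _ Dt; rewrite Nu exprMn [(rtoc c * _) ^+ 2]exprMn -mulrDl.
  have uE j : vec_at i u c 0 j = 0 by rewrite uc0 mxE.
  have u0 : u = 0 by have := uE i; rewrite mxE eqxx.
  have c0 : c = 0.
    have [j ji] : exists j : 'I_2, j != i.
      by have [->|->] := ord2_cases i; [exists 1|exists 0].
    by have := uE j; rewrite mxE (negbTE ji).
  by rewrite u0 c0 rtoc0 expr0n addr0 mul0r eqxx.
move=> t Et; have Dt := ED t Et; split; first exact: mem_set.
have [l dl] : exists l, is_derive (rtoc t) (1 : C) D l.
  by exists ('D_1 D (rtoc t)); exact/derivableP.
have l0 : l != 0 by have := simple _ Dt; case: dl => _ ->.
have := near_rtoc (isolated_zero dl l0 Dt).
move=> H; exists [set s | D (rtoc s) = 0 -> rtoc s = rtoc t]; first exact: H.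
apply/seteqP; split=> [s [/= Hs /ED /Hs/rtoc_inj]|s ->]//.
Qed.

End Criterion.

(** * Null geodesics *)

Section ScalarDerivatives.
Variables (R : numFieldType) (V : normedModType R).
Implicit Types (f g : V -> R) (x v : V) (a b : R).

Lemma is_derive_mul f g x v a b : is_derive x v f a -> is_derive x v g b ->
  is_derive x v (fun y => f y * g y) (f x * b + g x * a).
Proof. by move=> df dg; exact: (is_deriveM df dg). Qed.

Lemma is_derive_add f g x v a b : is_derive x v f a -> is_derive x v g b ->
  is_derive x v (fun y => f y + g y) (a + b).
Proof. by move=> df dg; exact: (is_deriveD df dg). Qed.

Lemma is_derive_inv f x v a : f x != 0 -> is_derive x v f a ->
  is_derive x v (fun y => (f y)^-1) (- (f x) ^- 2 * a).
Proof.
move=> fx [df <-]; split; first exact: derivableV.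
by rewrite deriveV.
Qed.

Lemma is_derive_sqr f x v a : is_derive x v f a ->
  is_derive x v (fun y => f y ^+ 2) (2 * f x * a).
Proof.
move=> df; have := is_derive_mul df df.
rewrite (_ : (fun y => f y ^+ 2) = (fun y => f y * f y)); last first.
  by apply/funext => y; rewrite expr2.
by congr is_derive; ring.
Qed.

Lemma is_derive_const (c : R) x v : is_derive x v (fun=> c) 0.
Proof. exact: is_derive_cst. Qed.

End ScalarDerivatives.

(** * Christoffel symbols of the metric and first integrals of null geodesics *)

Section NullGeodesics.
Variable R : realType.
Implicit Types (p v : 'rV[R]_2) (t : R).

Lemma is_derive_coord n (p v : 'rV[R]_n) j : is_derive p v (fun q => q 0 j) (v 0 j).
Proof.
have d := @derivable_id _ _ p v; split; first exact: (derivable_mxP _ _ _).1 d 0 j.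
by have := derive_mx d; rewrite derive_id => {2}->; rewrite mxE.
Qed.

Definition sqnorm p : R := p 0 0 ^+ 2 + p 0 1 ^+ 2.

Lemma sqnorm_gt0 p : p != 0 -> 0 < sqnorm p.
Proof.
move=> p0; rewrite lt_def addr_ge0 ?sqr_ge0// andbT.
apply: contraNneq p0 => /eqP; rewrite paddr_eq0 ?sqr_ge0// !sqrf_eq0.
move=> /andP[/eqP p0 /eqP p1]; apply/eqP/rowP => j; rewrite mxE.
by have [->|->] := ord2_cases j.
Qed.

Lemma is_derive_sqnorm p v :
  is_derive p v sqnorm (2 * p 0 0 * v 0 0 + 2 * p 0 1 * v 0 1).
Proof. by apply: is_derive_add; apply: is_derive_sqr; exact: is_derive_coord. Qed.

Lemma derive_Nmetric p v (j l : 'I_2) : p != 0 ->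
  'D_v (fun q => Nmetric q j l) p =
  if j == l then 0 else - (p 0 0 * v 0 0 + p 0 1 * v 0 1) / sqnorm p ^+ 2.
Proof.
move=> p0; have r0 : sqnorm p != 0 by rewrite gt_eqF ?sqnorm_gt0.
rewrite (_ : (fun q => _) = (fun q => if j == l then 0 else (2 * sqnorm q)^-1)); last first.
  by apply/funext => q; rewrite mxE.
case: eqP => _; first exact: derive_cst.
have d2 := is_derive_mul (is_derive_const 2 p v) (is_derive_sqnorm p v).
have r20 : 2 * sqnorm p != 0 by rewrite mulf_neq0.
have [_ ->] := @is_derive_inv _ _ (fun q => 2 * sqnorm q) p v _ r20 d2.
by field; exact: r0.
Qed.

Lemma invmx_Nmetric p : p != 0 ->
  invmx (Nmetric p) = \matrix_(i, j) (if i == j then 0 else 2 * sqnorm p).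
Proof.
move=> p0; have r0 : sqnorm p != 0 by rewrite gt_eqF ?sqnorm_gt0.
set B := \matrix_(i, j) _.
have AB : Nmetric p *m B = 1%:M.
  apply/matrixP => i j; rewrite !mxE !big_ord_recl big_ord0 !mxE -/(sqnorm p).
  by have [->|->] := ord2_cases i; have [->|->] := ord2_cases j;
    rewrite /= ?(mulr0, mul0r, addr0, add0r)//; field.
have [uA _] := mulmx1_unit AB.
by rewrite -[LHS]mulmx1 -AB mulKmx.
Qed.

(** For a metric whose only nonzero entry is an off-diagonal [F], the only nonzero symbols are the
    derivatives of [log F] along [k], for [i = j = k]; here [F = 1 / (2 (u^2 + v^2))]. *)
Lemma christoffel_Nmetric p (k i j : 'I_2) : p != 0 ->
  christoffel (@Nmetric R) k i j p =
  if (i == k) && (j == k) then - 2 * p 0 k / sqnorm p else 0.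
Proof.
move=> p0; have r0 : sqnorm p != 0 by rewrite gt_eqF ?sqnorm_gt0.
rewrite /christoffel invmx_Nmetric// !big_ord_recl big_ord0 !derive_Nmetric// !mxE.
by have [->|->] := ord2_cases k; have [->|->] := ord2_cases i;
  have [->|->] := ord2_cases j; rewrite /=; field.
Qed.

Lemma const_on_interval (I : set R) (f : R -> R) : is_interval I ->
  (forall t, I t -> is_derive t 1 f 0) -> forall s t, I s -> I t -> f s = f t.
Proof.
move=> iI df s t; wlog st : s t / s <= t.
  by move=> H Is It; have [st|/ltW ts] := leP s t; [exact: H|apply/esym/H].
move=> Is It; have Iu u : s <= u <= t -> I u by exact: iI.
have [| |u _] := @MVT_segment _ f (fun=> 0) s t st.
- by move=> u; rewrite in_itv/= => /andP[/ltW su /ltW ut]; apply/df/Iu; rewrite su.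
- apply: continuous_in_subspaceT => u /set_mem/=; rewrite in_itv/= => /Iu/df[du _].
  exact/differentiable_continuous/derivable1_diffP.
- by rewrite mul0r => /eqP; rewrite subr_eq0 => /eqP.
Qed.

(** With [r = u^2 + v^2] the geodesic equation reads [x_k'' = 2 x_k x_k'^2 / r]. In the derivative
    of [x_k' / r] the terms in [x_k'^2] cancel, and what is left is a multiple of [u' v']. *)
Lemma null_geodesic_speed (I : set R) (gamma : R -> 'rV[R]_2) :
  is_interval I -> (forall t, I t -> Nspace (gamma t)) ->
  geodesic (@Nmetric R) I gamma -> null_curve I gamma ->
  forall k : 'I_2, exists a : R, forall t, I t ->
    is_derive t 1 (fun s => gamma s 0 k) (a * sqnorm (gamma t)) /\
    derive1 gamma t 0 k = a * sqnorm (gamma t).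
Proof.
move=> iI gN gg gn k.
have dcoord (f : R -> 'rV[R]_2) t j : derivable f t 1 ->
    is_derive t 1 (fun s => f s 0 j) (derive1 f t 0 j).
  move=> df; split; first exact: (derivable_mxP _ _ _).1 df 0 j.
  by rewrite derive1E derive_mx// mxE.
pose w t := derive1 gamma t 0 k / sqnorm (gamma t).
have gN0 t : I t -> gamma t != 0 by move=> /gN.
have dw t : I t -> is_derive t 1 w 0.
  move=> It; have [dg ddg eq] := gg t It.
  have r0 : sqnorm (gamma t) != 0 by rewrite gt_eqF ?sqnorm_gt0 ?gN0.
  have dr : is_derive t 1 (fun s => sqnorm (gamma s))
      (2 * gamma t 0 0 * derive1 gamma t 0 0 + 2 * gamma t 0 1 * derive1 gamma t 0 1).
    by apply: is_derive_add; apply: is_derive_sqr; exact: dcoord.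
  have := is_derive_mul (dcoord _ _ k ddg) (@is_derive_inv _ _ (fun s => sqnorm (gamma s)) t 1 _ r0 dr).
  congr is_derive; move: (eq k) (gn t It); rewrite !big_ord_recl !big_ord0.
  rewrite (_ : lift ord0 ord0 = 1 :> 'I_2); last exact: val_inj.
  rewrite !christoffel_Nmetric ?gN0// => eqk null.
  (* Clearing the denominator [r^2] exposes the factor [u' v']. *)
  apply: (mulIf (expf_neq0 2 r0)); rewrite mul0r.
  have [kE|kE] := ord2_cases k; move: eqk; rewrite kE /= => /eqP;
    rewrite addr_eq0 => /eqP ->.
    transitivity (- 2 * gamma t 0 1 * (derive1 gamma t 0 0 * derive1 gamma t 0 1)).
      by rewrite /=; field.
    by rewrite null mulr0.
  transitivity (- 2 * gamma t 0 0 * (derive1 gamma t 0 0 * derive1 gamma t 0 1)).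
    by rewrite /=; field.
  by rewrite null mulr0.
have [[t0 It0]|I0] := pselect (I !=set0); last first.
  by exists 0 => t It; case: I0; exists t.
exists (w t0) => t It; rewrite (const_on_interval iI dw It0 It) /w divfK.
  by split=> //; apply: dcoord; have [] := gg t It.
by rewrite gt_eqF// sqnorm_gt0// gN0.
Qed.

End NullGeodesics.

(** * Completeness of null geodesics *)

Section Completeness.
Variable R : realType.
Local Notation C := (Cplx R).

Lemma is_derive_cexp_affine (k l : C) z : k != 0 ->
  is_derive z (1 : C) (fun w => cexp (k * w + l)) (k * cexp (k * z + l)).
Proof.
move=> k0; have k1 : 0 < cn k by rewrite cn_gt0.
apply/derive_cnP => e e0.
have /derive_cnP/(_ _ (divr_gt0 e0 k1))[d d0 Hd] := is_derive_cexp (k * z + l).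
exists (d / cn k) => [|w]; first by rewrite divr_gt0.
have E : k * w + l - (k * z + l) = k * (w - z) by ring.
rewrite ltr_pdivlMr// mulrC -cnM -E => /Hd; rewrite E => H.
rewrite -mulrA mulrCA; apply: le_trans H _.
by rewrite cnM mulrA divfK// gt_eqF.
Qed.

Lemma derivable_affine (k l z : C) : derivable (fun w => k * w + l) z 1.
Proof.
apply: derivableD; last exact: derivable_cst.
by apply: derivableM; [exact: derivable_cst|exact: derivable_id].
Qed.

(** Taking [D = 1] leaves no exceptional point. *)
Lemma complete_constant (I : set R) (gamma : R -> 'rV[R]_2) (p : 'rV[R]_2) :
  I !=set0 -> p != 0 -> (forall t, I t -> gamma t = p) -> complete_curve I gamma.
Proof.
move=> I0 p0 Ip.
apply: (@complete_criterion _ I gamma (cst (rtoc (p 0 0))) (cst 1) 0 (p 0 1) I0).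
- by move=> z; exact: derivable_cst.
- by move=> z; exact: derivable_cst.
- by move=> z /= /eqP; rewrite oner_eq0.
- by move=> z /= /eqP; rewrite oner_eq0.
- by move=> z /= /eqP; rewrite oner_eq0.
- move=> z _ /=; rewrite mulr1 !expr2 -!rtocM -rtocD -!expr2 -rtoc0 (inj_eq (@rtoc_inj R)).
  by rewrite gt_eqF//; exact: sqnorm_gt0.
- by move=> t _; exists (p 0 0); rewrite mulr1.
- by move=> t _; exact: oner_neq0.
- by move=> t It; rewrite (Ip t It) mulr1.
- by move=> t j It; rewrite (Ip t It); have [->|->] := ord2_cases j.
Qed.

(** Here [N = 1] and [D = b - a z], with the single real zero [b / a]. *)
Lemma complete_hyperbola (I : set R) (gamma : R -> 'rV[R]_2) (i : 'I_2) (a b : R) :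
  I !=set0 -> a != 0 ->
  (forall t, I t -> gamma t 0 i * (b - a * t) = 1) ->
  (forall t j, I t -> j != i -> gamma t 0 j = 0) -> complete_curve I gamma.
Proof.
move=> I0 a0 Iu Ij.
have DE t : - rtoc a * rtoc t + rtoc b = rtoc (b - a * t).
  by rewrite rtocD rtocN rtocM; ring.
have ra0 : - rtoc a != 0 by rewrite oppr_eq0 -rtoc0 (inj_eq (@rtoc_inj R)).
apply: (@complete_criterion _ I gamma (cst 1) (fun z => - rtoc a * z + rtoc b) i 0 I0).
- by move=> z; exact: derivable_cst.
- by move=> z; exact: derivable_affine.
- by move=> z _; exact: oner_neq0.
- move=> z _; suff [_ ->] : is_derive z (1 : C) (fun z => - rtoc a * z + rtoc b) (- rtoc a) by [].
  apply/derive_cnP => e e0; exists 1 => // w _.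
  rewrite (_ : _ - _ - _ = 0); last by ring.
  by rewrite cn0 mulr_ge0 ?cn_ge0// ltW.
- move=> z Dz; have -> : z = rtoc (b / a); last by [].
  apply: (mulfI ra0); rewrite rtocM rtocV; move/eqP: Dz; rewrite addr_eq0 => /eqP ->.
  by field; rewrite -oppr_eq0.
- by move=> z _; rewrite rtoc0 mul0r expr0n addr0 expr1n oner_neq0.
- move=> t; rewrite DE => Dt; exists (b - a * t)^-1.
  by rewrite rtocV mulVf.
- move=> t It; rewrite DE -rtoc0 (inj_eq (@rtoc_inj R)); apply/eqP => Dt.
  by have /eqP := Iu t It; rewrite Dt mulr0 eq_sym oner_eq0.
- by move=> t It; rewrite DE -rtocM Iu.
- exact: Ij.
Qed.

(* With [e = exp (2 i (a z + b))], [tan (a z + b) = - i (e - 1) / (e + 1)]. *)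
Lemma complete_tangent (I : set R) (gamma : R -> 'rV[R]_2) (i : 'I_2) (a b c : R) :
  I !=set0 -> a != 0 -> c != 0 ->
  (forall t, I t -> cos (a * t + b) != 0) ->
  (forall t, I t -> gamma t 0 i = c * tan (a * t + b)) ->
  (forall t j, I t -> j != i -> gamma t 0 j = c) -> complete_curve I gamma.
Proof.
move=> I0 a0 c0 Icos Iu Ij.
pose k : C := Cpt 0 (2 * a); pose l : C := Cpt 0 (2 * b).
pose e z := cexp (k * z + l).
have k0 : k != 0 by rewrite -cn_gt0 (lt_le_trans _ (Im_le_cn _))//= normr_gt0 mulf_neq0.
have de z : is_derive z (1 : C) e (k * e z) by exact: is_derive_cexp_affine.
have dD z : is_derive z (1 : C) (fun w => e w + 1) (k * e z).
  rewrite -[k * e z]addr0; exact: (is_derive_add (de z) (is_derive_const (1 : C) z 1)).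
have rc0 : rtoc c != 0 by rewrite -rtoc0 (inj_eq (@rtoc_inj R)).
have i0 : Cpt 0 1 != 0 :> C by rewrite -cn_gt0 cn_i.
have ii : Cpt 0 1 * Cpt 0 1 = -1 :> C by apply/eqP; rewrite eq_complex /=; apply/andP; split; apply/eqP; ring.
have eE t : e (rtoc t) = Cpt (cos (a * t + b)) (sin (a * t + b)) ^+ 2.
  rewrite /e (_ : k * rtoc t + l = Cpt 0 ((a * t + b) + (a * t + b))).
    rewrite cexp_i; move: (a * t + b) => s; rewrite cosD sinD expr2.
    by apply/eqP; rewrite eq_complex /=; apply/andP; split; apply/eqP; ring.
  by apply/eqP; rewrite /k /l eq_complex /=; apply/andP; split; apply/eqP; ring.
(* With [w] the unit number of angle [a t + b], [e + 1 = 2 cos(a t + b) w] and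
   [e - 1 = 2 i sin(a t + b) w]; the quotient of these is [i tan(a t + b)]. *)
have DE t : e (rtoc t) + 1 =
    rtoc (2 * cos (a * t + b)) * Cpt (cos (a * t + b)) (sin (a * t + b)).
  rewrite eE; have := cos2Dsin2 (a * t + b); move: (cos _) (sin _) => x y xy.
  apply/eqP; rewrite expr2 eq_complex /= -[X in _ + X]xy.
  by apply/andP; split; apply/eqP; ring.
have NE t : - (rtoc c * Cpt 0 1) * (e (rtoc t) - 1) =
    rtoc (2 * c * sin (a * t + b)) * Cpt (cos (a * t + b)) (sin (a * t + b)).
  rewrite eE; have := cos2Dsin2 (a * t + b); move: (cos _) (sin _) => x y xy.
  rewrite (_ : 1 = rtoc (x ^+ 2 + y ^+ 2)); last by rewrite xy.
  apply/eqP; rewrite expr2 eq_complex /=.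
  by apply/andP; split; apply/eqP; ring.
have tanE t : cos (a * t + b) != 0 -> - (rtoc c * Cpt 0 1) * (e (rtoc t) - 1) =
    rtoc (c * tan (a * t + b)) * (e (rtoc t) + 1).
  move=> ct; rewrite NE DE mulrA -rtocM; congr (rtoc _ * _).
  by rewrite /tan; field.
have cis0 t : Cpt (cos t) (sin t) != 0 :> C by rewrite -cexp_i cexp_neq0.
apply: (@complete_criterion _ I gamma (fun z => - (rtoc c * Cpt 0 1) * (e z - 1))
  (fun z => e z + 1) i c I0).
- move=> z; have [] := is_derive_mul (is_derive_const (- (rtoc c * Cpt 0 1)) z 1)
    (is_derive_add (de z) (is_derive_const (-1 : C) z 1)).
  by [].
- by move=> z; have [] := dD z.
(* At a zero of [D], [e = -1] and the numerator is [2 i c]. *)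
- move=> z /eqP; rewrite addr_eq0 => /eqP ->.
  by rewrite mulf_neq0 ?oppr_eq0 ?mulf_neq0// -opprD oppr_eq0 (_ : 1 + 1 = 2%:R)// pnatr_eq0.
- by move=> z _; have [_ ->] := dD z; rewrite mulf_neq0// cexp_neq0.
(* From [|e| = 1] the exponent has real part 0, that is, [- 2 a Im z = 0]. *)
- move=> z /eqP; rewrite addr_eq0 => /eqP ez.
  have : cn (e z) = 1 by rewrite ez cnN -rtoc1 cn_rtoc normr1.
  rewrite /e cn_cexp -expR0 => /expR_inj.
  case: (z) => x y /= /eqP; rewrite mul0r sub0r addr0 oppr_eq0.
  by rewrite !mulf_eq0 pnatr_eq0 (negbTE a0) /= => /eqP.
- move=> z _.
  (* The sum is [c^2 ((e + 1)^2 - (e - 1)^2) = 4 c^2 e], and the exponential has no zero. *)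
  have -> : (- (rtoc c * Cpt 0 1) * (e z - 1)) ^+ 2 + (rtoc c * (e z + 1)) ^+ 2 =
      rtoc c ^+ 2 * ((Cpt 0 1 * Cpt 0 1) * (e z - 1) ^+ 2 + (e z + 1) ^+ 2) by ring.
  rewrite ii (_ : -1 * _ + _ = 4 * e z); last by ring.
  by rewrite mulf_neq0 ?expf_neq0// mulf_neq0 ?pnatr_eq0// cexp_neq0.
- move=> t Dt; exists (c * tan (a * t + b)); apply: tanE.
  by apply: contraNneq Dt => ct; rewrite DE ct mulr0 rtoc0 mul0r.
- move=> t It; rewrite DE mulf_neq0 ?cis0//.
  by rewrite -rtoc0 (inj_eq (@rtoc_inj R)) mulf_neq0 ?Icos.
- by move=> t It; rewrite Iu//; apply: tanE; exact: Icos.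
- exact: Ij.
Qed.

Lemma complete_half (I : set R) (gamma : R -> 'rV[R]_2) (i j : 'I_2) (a : R) :
  I !=set0 -> is_interval I -> (forall t, I t -> Nspace (gamma t)) -> j != i ->
  (forall t, I t -> is_derive t 1 (fun s => gamma s 0 i) (a * sqnorm (gamma t))) ->
  (forall t, I t -> is_derive t 1 (fun s => gamma s 0 j) 0) ->
  complete_curve I gamma.
Proof.
move=> I0 iI gN ji di dj; have [t0 It0] := I0.
pose u t := gamma t 0 i; pose c := gamma t0 0 j.
have jE (j' : 'I_2) : j' != i -> j' = j.
  by move: ji; have [->|->] := ord2_cases i; have [->|->] := ord2_cases j;
    have [->|->] := ord2_cases j'.
have vc t : I t -> gamma t 0 j = c by move=> It; exact: (const_on_interval iI dj).
have gE t j' : I t -> j' != i -> gamma t 0 j' = c by move=> It /jE->; exact: vc.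
have nE t : I t -> sqnorm (gamma t) = u t ^+ 2 + c ^+ 2.
  move=> It; rewrite -(vc t It) /sqnorm /u; move: ji.
  by have [->|->] := ord2_cases i; have [->|->] := ord2_cases j => //; rewrite addrC.
have {}di t : I t -> is_derive t 1 u (a * (u t ^+ 2 + c ^+ 2)).
  by move=> It; rewrite -nE//; exact: di.
have [a0|a0] := eqVneq a 0.
  apply: (@complete_constant I gamma (gamma t0)) => //; first exact: gN.
  move=> t It; apply/rowP => j'; have [->|/[dup] j'i /jE ->] := eqVneq j' i.
    have du0 s : I s -> is_derive s 1 u 0 by move=> /di; rewrite a0 mul0r.
    exact: (const_on_interval iI du0 It It0).
  by rewrite vc.
have [c0|c0] := eqVneq c 0.
  (* The other coordinate is 0 and the curve avoids the origin. *)
  have u0 t : I t -> u t != 0.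
    move=> It; have := nE t It; rewrite c0 expr0n addr0 => H.
    by rewrite -sqrf_eq0 -H gt_eqF// sqnorm_gt0//; exact: gN.
  pose h t := (u t)^-1 + a * t.
  have dh t : I t -> is_derive t 1 h 0.
    move=> It; have d1 := is_derive_inv (u0 t It) (di t It).
    have := is_derive_add d1 (is_derive_mul (is_derive_const a t 1) (is_derive_id t 1)).
    by congr is_derive; rewrite c0; field; exact: u0.
  apply: (@complete_hyperbola I gamma i a (h t0)) => //; last by move=> t j' It /(gE t j' It)->.
  move=> t It; rewrite (const_on_interval iI dh It0 It) /h addrK.
  by apply: divff; exact: u0.
(* A first integral of [u' = a (u^2 + c^2)], as [1 / u + a t] was for [c = 0]. *)
pose h t := atan (u t / c) - a * c * t.
have dh t : I t -> is_derive t 1 h 0.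
  move=> It; have d1 := is_derive_mul (di t It) (is_derive_const c^-1 t 1).
  have d2 := @is_derive1_comp _ (@atan R) (fun s => u s / c) t _ _
    (is_derive1_atan (u t / c)) d1.
  have d3 := is_derive_mul (is_derive_const (- (a * c)) t 1) (is_derive_id t 1).
  rewrite (_ : h = (fun s => atan (u s / c) + - (a * c) * s)); last first.
    by apply/funext => s; rewrite mulNr.
  have := is_derive_add d2 d3; congr is_derive; field; rewrite c0 /= gt_eqF//.
  have : 0 < c ^+ 2 by rewrite exprn_even_gt0.
  by have := sqr_ge0 (u t); nra.
have hE t : I t -> atan (u t / c) = a * c * t + h t0.
  by move=> It; rewrite (const_on_interval iI dh It0 It) /h; ring.
apply: (@complete_tangent I gamma i (a * c) (h t0) c) => //.
- by rewrite mulf_neq0.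
(* On [I] the angle is a value of [atan], hence in the open interval where [cos] is positive. *)
- by move=> t It; rewrite -hE// gt_eqF// cos_gt0_pihalf// atan_gtNpi2 atan_ltpi2.
- by move=> t It; rewrite -hE// atanK mulrC divfK.
Qed.

End Completeness.

Theorem proposition62 (R : realType) (I : set R) (gamma : R -> 'rV[R]_2)
    (I_nonempty : I !=set0) (I_open : open I) (I_interval : is_interval I)
    (gamma_N : forall t, I t -> Nspace (gamma t))
    (gamma_geodesic : geodesic (@Nmetric R) I gamma)
    (gamma_null : null_curve I gamma) :
  complete_curve I gamma.
Proof.
have speed := null_geodesic_speed I_interval gamma_N gamma_geodesic gamma_null.
have [a0 H0] := speed 0; have [a1 H1] := speed 1; have [t0 It0] := I_nonempty.
(* Nullity at the one point [t0] already gives [a0 * a1 = 0], since the squared norm there is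
   positive; the vanishing constant then makes its coordinate stationary on all of [I]. *)
have /eqP := gamma_null t0 It0.
rewrite (H0 t0 It0).2 (H1 t0 It0).2 !mulf_eq0 (gt_eqF (sqnorm_gt0 (gamma_N _ It0))) !orbF.
case/orP => /eqP a_eq0.
  apply: (@complete_half _ I gamma 1 0 a1) => // t It; first exact: (H1 t It).1.
  by have := (H0 t It).1; rewrite a_eq0 mul0r.
apply: (@complete_half _ I gamma 0 1 a0) => // t It; first exact: (H0 t It).1.
by have := (H1 t It).1; rewrite a_eq0 mul0r.
Qed.
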